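(* Let $X$ be a uniformly locally finite metric space such that all of its sparse subspaces yield only compact ghost projections in their Roe algebras. Then $X$ is uniform Roe rigid.
   Context: A metric space $(X,d)$ is uniformly locally finite (u.l.f.) if $\sup_{x\in X}|\{y\in X: d(x,y)\le r\}|<\infty$ for all $r>0$. A map $f:(X,d)\to(Y,\partial)$ is a coarse equivalence if for all $s>0$ there is $r>0$ such that $d(x,y)<s$ implies $\partial(f(x),f(y))<r$, for all $r>0$ there is $s>0$ such that $d(x,y)>s$ implies $\partial(f(x),f(y))>r$, and $\sup_{y\in Y}\partial(y,f(X))<\infty$; $X$ and $Y$ are coarsely equivalent if such an $f$ exists. Fix an infinite dimensional separable Hilbert space $H_X$. For $a\in\mathcal B(\ell_2(X,H_X))$ let $a_{xy}=e_{yy}ae_{xx}\in\mathcal B(H_X)$, where $e_{xx}$ is the projection onto $\delta_x\otimes H_X$, and let $\mathrm{prop}(a)=\sup\{d(x,y):a_{xy}\neq0\}$. The Roe algebra $\mathrm{C}^*(X)$ is the norm closure of the set of all $a$ with $\mathrm{prop}(a)<\infty$ and all $a_{xy}$ compact. The uniform Roe algebra $\mathrm{C}^*_u(X)$ is the norm closure of the finite propagation operators in $\mathcal B(\ell_2(X))$. $X$ is uniform Roe rigid if $X$ is coarsely equivalent to every u.l.f. metric space $Y$ such that $\mathrm{C}^*_u(X)$ and $\mathrm{C}^*_u(Y)$ are $*$-isomorphic. An operator $a\in\mathrm{C}^*(X)$ is a ghost if for all $\epsilon>0$ there is a finite $A\subset X$ with $\|a_{xy}\|<\epsilon$ for all $x,y\notin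 A$. A metric space $X$ is sparse if there is a partition $X=\bigsqcup_{n\in\mathbb N}X_n$ into finite (possibly empty) sets with $d(X_n,X_m)\to\infty$ as $n+m\to\infty$, $n\ne m$. ''All sparse subspaces of $X$ yield only compact ghost projections in their Roe algebras'' means: for every sparse subspace $X'\subset X$ (with the restricted metric), every ghost projection in $\mathrm{C}^*(X')$ is compact. *)

(* Defs.v *)
From HB Require Import structures.
From mathcomp Require Import all_boot all_order all_algebra.
From mathcomp Require Import finmap sesquilinear complex.
From mathcomp Require Import all_classical all_reals all_analysis.
From mathcomp Require Import ring lra.
From mathcomp Require summability.

Set Implicit Arguments.
Unset Strict Implicit.
Unset Printing Implicit Defensive.

Import Order.TTheory GRing.Theory Num.Def Num.Theory.
Import numFieldNormedType.Exports.

Local Open Scope classical_set_scope.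
Local Open Scope ring_scope.

HB.factory Record isInner (C : numClosedFieldType) (U : lmodType C)
    (op : U -> U -> C) := {
  op_linear : forall w, GRing.linear_for *%R (op ^~ w) ;
  op_conj : forall u v, op u v = (op v u)^* ;
  op_gt0 : forall u, u != 0 -> 0 < op u u
}.

HB.builders Context C U op of isInner C U op.

Let op_linearr (u : U) : GRing.linear_for (conjC \; *%R) (op u).
Proof.
move=> a v w; rewrite op_conj op_linear rmorphD rmorphM/=.
by rewrite -(op_conj u v) -(op_conj u w).
Qed.

HB.instance Definition _ := @bilinear_isBilinear.Build C U U C
  *%R (conjC \; *%R) op (op_linear, op_linearr).

Let op_herm (u v : U) : op u v = (-1) ^+ false * (op v u)^*.
Proof. by rewrite expr0 mul1r; exact: op_conj. Qed.

HB.instance Definition _ :=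
  @isHermitianSesquilinear.Build C U false conjC op op_herm.

HB.instance Definition _ := isDotProduct.Build C U op op_gt0.

HB.end.

Section cauchy_schwarz.
Context {C : numClosedFieldType} {U : lmodType C}.
Variable form : {dot U for (@conjC C)}.

Lemma dot_conj u v : form u v = (form v u)^*.
Proof. by rewrite hermC expr0 mul1r. Qed.

Lemma dot_CauchySchwarz u v :
  `|form u v| <= sqrtC (form u u) * sqrtC (form v v).
Proof.
have [->|v0] := eqVneq v 0; first by rewrite !linear0r sqrtC0 mulr0 normr0.
have vv0 : 0 < form v v by rewrite dnorm_gt0.
have [a aE] : exists a, a = form u v / form v v by exists (form u v / form v v).
have cvv : (form v v)^* = form v v by rewrite -dot_conj.
have caE : a^* = (form u v)^* / form v v by rewrite aE rmorphM/= fmorphV/= cvv.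
have := dnorm_ge0 form (u - a *: v).
rewrite dnormB dnormZ linearZr_LR/= rmorphM/= conjCK normCK caE aE => h.
have {}h : form u v * (form u v)^* / form v v <= form u u.
  rewrite -subr_ge0; apply: le_trans h _; rewrite le_eqVlt; apply/orP; left.
  by apply/eqP; field; rewrite gt_eqF.
rewrite -(@ler_pXn2r _ 2)// ?nnegrE ?mulr_ge0 ?sqrtC_ge0 ?dnorm_ge0//.
by rewrite exprMn !sqrtCK normCK -ler_pdivrMr.
Qed.

Lemma dot_triangle u v :
  sqrtC (form (u + v) (u + v)) <= sqrtC (form u u) + sqrtC (form v v).
Proof.
rewrite -(@ler_pXn2r _ 2)// ?nnegrE ?addr_ge0 ?sqrtC_ge0 ?dnorm_ge0//.
rewrite sqrrD !sqrtCK dnormD [leRHS]addrAC lerD2l.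
have r := @leif_Re_Creal C (form u v).
apply: (@le_trans _ _ (`|form u v| *+ 2)); last first.
  by rewrite lerMn2r dot_CauchySchwarz orbT.
have -> : form u v + (form u v)^* = 'Re (form u v) *+ 2.
  by rewrite ReE -mulr_natr divfK// pnatr_eq0.
by rewrite lerMn2r r.
Qed.

End cauchy_schwarz.

HB.mixin Record NormedModule_isPreHilbert (R : realType) V
    & NormedModule R[i] V := {
  inner : {dot V for (@conjC R[i])} ;
  inner_norm : forall u : V, inner u u = `|u| ^+ 2
}.

#[short(type="preHilbertType")]
HB.structure Definition PreHilbert (R : realType) :=
  {V of NormedModule R[i] V & NormedModule_isPreHilbert R V}.

#[short(type="hilbertType")]
HB.structure Definition Hilbert (R : realType) :=
  {V of PreHilbert R V & Complete V}.

(* The norm of a normed module over R[i] takes its values in R[i];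
   rnorm is the same norm with values in R. *)
Definition rnorm (R : realType) (V : normedModType R[i]) (v : V) : R :=
  complex.Re `|v|.

Section rnorm_theory.
Context {R : realType} {V : normedModType R[i]}.
Implicit Types u v : V.

Lemma rnormE v : (rnorm v)%:C%C = `|v|.
Proof. by rewrite /rnorm RRe_real// normr_real. Qed.

Lemma rnorm_ge0 v : 0 <= rnorm v.
Proof. by rewrite -ler0c rnormE. Qed.

Lemma rnorm0 : rnorm (0 : V) = 0.
Proof. by rewrite /rnorm normr0. Qed.

Lemma rnormD u v : rnorm (u + v) <= rnorm u + rnorm v.
Proof. by rewrite -lecR rmorphD/= !rnormE ler_normD. Qed.

Lemma rnormZ (a : R[i]) v : rnorm (a *: v) = rnorm (a : R[i]^o) * rnorm v.
Proof. by apply: complexI; rewrite rmorphM/= !rnormE normrZ. Qed.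

End rnorm_theory.

Section scalar_prehilbert.
Variable R : realType.

Definition scalar_inner (a b : R[i]^o) : R[i] := a * conjC (b : R[i]).

Let scalar_inner_linear (b : R[i]^o) :
  GRing.linear_for *%R (scalar_inner ^~ b).
Proof. by move=> c a a'; rewrite /scalar_inner mulrDl /GRing.scale/= mulrA. Qed.

Let scalar_inner_conj (a b : R[i]^o) :
  scalar_inner a b = (scalar_inner b a)^*.
Proof. by rewrite /scalar_inner rmorphM/= conjCK mulrC. Qed.

Let scalar_inner_gt0 (a : R[i]^o) : a != 0 -> 0 < scalar_inner a a.
Proof. by move=> a0; rewrite /scalar_inner -normCK exprn_gt0// normr_gt0. Qed.

HB.instance Definition _ := @isInner.Build R[i] R[i]^o scalar_inner
  scalar_inner_linear scalar_inner_conj scalar_inner_gt0.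

Let scalar_inner_norm (a : R[i]^o) : scalar_inner a a = `|a| ^+ 2.
Proof. by rewrite normCK. Qed.

HB.instance Definition _ := @NormedModule_isPreHilbert.Build R R[i]^o
  (scalar_inner : {dot R[i]^o for (@conjC R[i])}) scalar_inner_norm.

End scalar_prehilbert.

#[local] Existing Instance summability.totally_filter.

Section unordered_sums.
Context {R : realType} {X : choiceType}.
Local Notation C := (R[i]^o).
Implicit Types (u : X -> R) (f g : X -> C).

Let psum f := @summability.partial_sum X C f.

Lemma partial_sumE (V : zmodType) (f : X -> V) (A : {fset X}) :
  summability.partial_sum f A = \sum_(x <- A) f x.
Proof. by rewrite big_seq_fsetE. Qed.

Definition has_sum f := cvg (psum f @ summability.totally).

Lemma sum_cvg f : has_sum f -> psum f @ summability.totally --> summability.sum f.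
Proof. by []. Qed.

Lemma sum_eq f (l : C) : psum f @ summability.totally --> l -> summability.sum f = l.
Proof. by move=> fl; apply: (@cvg_lim C) => //; exact: norm_hausdorff. Qed.

Lemma sum_cvgD f g (l m : C) :
  psum f @ summability.totally --> l -> psum g @ summability.totally --> m ->
  psum (f \+ g) @ summability.totally --> l + m.
Proof.
move=> fl gm; have -> : psum (f \+ g) = psum f \+ psum g.
  by apply/funext => A; rewrite /psum /= !partial_sumE big_split.
exact: (@cvgD R[i] C _ _ _ _ _ _ _ fl gm).
Qed.

Lemma sum_cvgZ (a : R[i]) f (l : C) :
  psum f @ summability.totally --> l ->
  psum (a \*: f) @ summability.totally --> a *: l.
Proof.
move=> fl; rewrite (_ : psum (a \*: f) = a \*: psum f); first exact: cvgZl_tmp.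
by apply/funext => A; rewrite /psum /= !partial_sumE scaler_sumr.
Qed.

Lemma sum_cvg_conj f (l : C) :
  psum f @ summability.totally --> l ->
  psum (fun x => (f x)^* : C) @ summability.totally --> (l^* : C).
Proof.
move=> /cvgrPdist_lt fl; apply/cvgrPdist_lt => e /fl; apply: filterS => A.
rewrite /psum !partial_sumE => h.
by rewrite -rmorph_sum -rmorphB norm_conjC.
Qed.

Lemma sum_cvg_ge0 u (M : R) : (forall x, 0 <= u x) ->
  (forall A : {fset X}, \sum_(x <- A) u x <= M) ->
  psum (fun x => (u x)%:C%C) @ summability.totally -->
    ((sup [set \sum_(x <- A) u x | A in [set: {fset X}]])%:C%C : C).
Proof.
move=> u0 uM; set S := [set \sum_(x <- A) u x | A in [set: {fset X}]].
have supS : has_sup S.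
  split; first by exists (\sum_(x <- fset0) u x), fset0.
  by exists M => _ [A _ <-]; exact: uM.
apply/cvgrPdist_lt => e e0.
have eE : e = (complex.Re e)%:C%C by rewrite RRe_real// gtr0_real.
have Re0 : 0 < complex.Re e by rewrite -ltcR -eE.
have [_ [A _ <-] SA] := sup_adherent Re0 supS.
exists A => // B /= AB; rewrite /psum partial_sumE -rmorph_sum -rmorphB/=.
have le_B : \sum_(x <- B) u x <= sup S.
  by apply: sup_ubound; [case: supS|exists B].
rewrite ger0_norm; last by rewrite ler0c subr_ge0.
rewrite eE ltcR ltrBlDr -ltrBlDl (lt_le_trans SA)//.
rewrite [leRHS](big_fsetID _ (mem A))/=.
have -> : [fset x in B | mem A x]%fset = A.
  by apply/fsetP => x; rewrite !inE/=; apply: andb_idl; exact: (fsubsetP AB).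
by rewrite lerDl sumr_ge0.
Qed.

End unordered_sums.

Arguments sum_cvgZ {R X} a {f l} _.

Section ell2_def.
Context {R : realType} {X : choiceType} {V : preHilbertType R}.
Local Notation C := (R[i]^o).

Definition square_summable (f : X -> V) : Prop :=
  (\esum_(x in [set: X]) (rnorm (f x) ^+ 2)%:E < +oo)%E.

Lemma square_summableP (f : X -> V) : square_summable f <->
  exists M : R, forall A : {fset X}, \sum_(x <- A) rnorm (f x) ^+ 2 <= M.
Proof.
split=> [fs|[M fM]].
- pose s := (\esum_(x in [set: X]) (rnorm (f x) ^+ 2)%:E)%E.
  have s0 : (0 <= s)%E by apply: esum_ge0 => x _; rewrite lee_fin sqr_ge0.
  have sfin : s \is a fin_num by rewrite ge0_fin_numE.
  exists (fine s) => A; rewrite -lee_fin fineK// -sumEFin.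
  apply: esum_ge; exists [set` A]; first by split; [exact: finite_fset|].
  by rewrite fsbig_seq//=; exact: fset_uniq.
- rewrite /square_summable (@le_lt_trans _ _ M%:E) ?ltry//.
  apply: ge_ereal_sup => _ [A [Afin _] <-].
  by rewrite fsbig_finite// sumEFin lee_fin.
Qed.

Definition ell2_pred : {pred X -> V} := fun f => `[< square_summable f >].

Lemma ell2_submod_closed : submod_closed ell2_pred.
Proof.
split.
  apply/asboolP/square_summableP; exists 0 => A; rewrite big1// => x _.
  by rewrite rnorm0 expr0n.
move=> a f g /asboolP/square_summableP[M fM] /asboolP/square_summableP[N gN].
pose c := rnorm (a : C) ^+ 2.
apply/asboolP/square_summableP; exists ((c * M + N) *+ 2) => A.
apply: (@le_trans _ _ (\sum_(x <- A)
    (c * rnorm (f x) ^+ 2 + rnorm (g x) ^+ 2) *+ 2)).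
  apply: ler_sum => x _; rewrite /c -exprMn -rnormZ.
  apply: (@le_trans _ _ ((rnorm (a *: f x) + rnorm (g x)) ^+ 2)).
    by rewrite lerXn2r ?nnegrE ?addr_ge0 ?rnorm_ge0// rnormD.
  rewrite -subr_ge0 (_ : _ - _ = (rnorm (a *: f x) - rnorm (g x)) ^+ 2) ?sqr_ge0//.
  by ring.
rewrite sumrMnl lerMn2r /= big_split/= -mulr_sumr lerD//.
by rewrite ler_wpM2l// sqr_ge0.
Qed.

HB.instance Definition _ :=
  GRing.isSubmodClosed.Build R[i] (X -> V) ell2_pred ell2_submod_closed.

End ell2_def.

Record ell2 (R : realType) (X : choiceType) (V : preHilbertType R) :=
  Ell2 { ell2_fun :> X -> V ; _ : ell2_fun \in ell2_pred }.
Arguments ell2 {R} X V.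

Section ell2_lmod.
Context {R : realType} {X : choiceType} {V : preHilbertType R}.

HB.instance Definition _ := [isSub for @ell2_fun R X V].
HB.instance Definition _ := [Choice of ell2 X V by <:].
HB.instance Definition _ := [SubChoice_isSubLmodule of ell2 X V by <:].

End ell2_lmod.

Section ell2_inner.
Context {R : realType} {X : choiceType} {V : preHilbertType R}.
Local Notation C := (R[i]^o).
Implicit Types f g h : ell2 X V.

Let sqn f := fun x => (rnorm (f x) ^+ 2)%:C%C : C.

Let sqnE f x : sqn f x = inner (f x) (f x).
Proof. by rewrite inner_norm /sqn rmorphXn/= rnormE. Qed.

Lemma ell2_square_summable f : square_summable f.
Proof. by case: f => f fP; exact/asboolP. Qed.

Let sqn_cvg f : summability.partial_sum (sqn f) @ summability.totally -->
  ((sup [set \sum_(x <- A) rnorm (f x) ^+ 2 | A in [set: {fset X}]])%:C%C : C).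
Proof.
have /square_summableP[M fM] := ell2_square_summable f.
by apply: (sum_cvg_ge0 _ fM) => x; rewrite sqr_ge0.
Qed.

Let polarization (v w : V) : inner v w = 4^-1 *
  (inner (v + w) (v + w) + (-1) * inner (v - w) (v - w)
   + 'i * inner (v + 'i *: w) (v + 'i *: w)
   + (- 'i) * inner (v - 'i *: w) (v - 'i *: w)).
Proof.
rewrite !dnormB !dnormD !dnormZ !linearZr_LR/= !rmorphM/= conjCK conjCi.
set a := inner v w; have -> : 'i * a^* = - (- 'i * a^*) by rewrite mulNr opprK.
have i2 : 'i * 'i = -1 :> R[i] by rewrite -expr2 sqrCi.
have -> : 'i * (inner v v + `|'i| ^+ 2 * inner w w + (- 'i * a - (- 'i * a^*)))
  = 'i * (inner v v + `|'i| ^+ 2 * inner w w) - ('i * 'i) * a + ('i * 'i) * a^*.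
  by ring.
have -> : - 'i * (inner v v + `|'i| ^+ 2 * inner w w - (- 'i * a - (- 'i * a^*)))
  = - 'i * (inner v v + `|'i| ^+ 2 * inner w w) - ('i * 'i) * a
    + ('i * 'i) * a^*.
  by ring.
by rewrite i2; field.
Qed.

Definition ell2_inner f g : R[i] :=
  summability.sum (fun x => inner (f x) (g x) : C).

Lemma ell2_inner_cvg f g :
  summability.partial_sum (fun x => inner (f x) (g x) : C)
    @ summability.totally --> (ell2_inner f g : C).
Proof.
apply: sum_cvg; apply/cvg_ex.
have := sum_cvgZ (4^-1) (sum_cvgD (sum_cvgD (sum_cvgD (@sqn_cvg (f + g))
  (sum_cvgZ (-1) (@sqn_cvg (f - g))))
  (sum_cvgZ 'i (@sqn_cvg (f + 'i *: g))))
  (sum_cvgZ (- 'i) (@sqn_cvg (f - 'i *: g)))).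
set F := (F in summability.partial_sum F) => fgl; eexists.
rewrite (_ : (fun x => _) = F); first exact: fgl.
by apply/funext => x; rewrite /F /= !sqnE polarization.
Qed.

Let ell2_inner_linear h : GRing.linear_for *%R (ell2_inner ^~ h).
Proof.
move=> a f g; apply: sum_eq.
have := sum_cvgD (sum_cvgZ a (@ell2_inner_cvg f h)) (@ell2_inner_cvg g h).
set F := (F in summability.partial_sum F) => fgh.
rewrite (_ : (fun x => _) = F); first exact: fgh.
by apply/funext => x; rewrite /F /= linearPl.
Qed.

Let ell2_inner_conj f g : ell2_inner f g = (ell2_inner g f)^*.
Proof.
apply: sum_eq; have := sum_cvg_conj (@ell2_inner_cvg g f).
set F := (F in summability.partial_sum F) => fg.
rewrite (_ : (fun x => _) = F); first exact: fg.
by apply/funext => x; rewrite /F /= -dot_conj.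
Qed.

Let ell2_inner_gt0 f : f != 0 -> 0 < ell2_inner f f.
Proof.
move=> f0.
have -> : ell2_inner f f =
    (sup [set \sum_(x <- A) rnorm (f x) ^+ 2 | A in [set: {fset X}]])%:C%C.
  apply: sum_eq; rewrite (_ : (fun x => _) = sqn f); first exact: sqn_cvg.
  by apply/funext => x; rewrite sqnE.
have [x fx0] : exists x, f x != 0.
  apply: contrapT => /forallNP fx; move/eqP: f0; apply; apply: val_inj.
  by apply/funext => x; apply/eqP/negPn/negP; exact: fx.
have /square_summableP[M fM] := ell2_square_summable f.
rewrite ltcR; apply: (@lt_le_trans _ _ (rnorm (f x) ^+ 2)).
  by rewrite exprn_gt0// -ltcR rnormE normr_gt0.
apply: ub_le_sup; first by exists M => _ [A _ <-]; exact: fM.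
by exists [fset x]%fset => //; rewrite big_seq_fset1.
Qed.

HB.instance Definition _ := @isInner.Build R[i] (ell2 X V) ell2_inner
  ell2_inner_linear ell2_inner_conj ell2_inner_gt0.

Definition ell2_norm f : R[i] := sqrtC (ell2_inner f f).

Let ell2_norm_triangle f g : ell2_norm (f + g) <= ell2_norm f + ell2_norm g.
Proof. exact: (dot_triangle (ell2_inner : {dot _ for (@conjC R[i])})). Qed.

Let ell2_normZ (a : R[i]) f : ell2_norm (a *: f) = `|a| * ell2_norm f.
Proof.
rewrite /ell2_norm (dnormZ (ell2_inner : {dot _ for (@conjC R[i])})).
by rewrite sqrtCM ?nnegrE ?exprn_ge0// ?dnorm_ge0// sqrCK.
Qed.

Let ell2_norm0_eq0 f : ell2_norm f = 0 -> f = 0.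
Proof.
move/eqP; rewrite /ell2_norm sqrtC_eq0.
by rewrite (dnorm_eq0 (ell2_inner : {dot _ for (@conjC R[i])})) => /eqP.
Qed.

HB.instance Definition _ := @Lmodule_isNormed.Build R[i] (ell2 X V)
  ell2_norm ell2_norm_triangle ell2_normZ ell2_norm0_eq0.

Let ell2_inner_norm f : ell2_inner f f = `|f| ^+ 2.
Proof. by rewrite sqrtCK. Qed.

HB.instance Definition _ := @NormedModule_isPreHilbert.Build R (ell2 X V)
  (ell2_inner : {dot _ for (@conjC R[i])}) ell2_inner_norm.

End ell2_inner.

Section ell2_delta.
Context {R : realType} {X : choiceType} {V : preHilbertType R}.

Definition delta_fun (x : X) (v : V) : X -> V :=
  fun y => if y == x then v else 0.

Lemma delta_fun_ell2 (x : X) (v : V) : delta_fun x v \in @ell2_pred R X V.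
Proof.
apply/asboolP/square_summableP; exists (rnorm v ^+ 2) => A.
have d0 y : y \notin [fset x]%fset -> rnorm (delta_fun x v y) ^+ 2 = 0.
  by rewrite inE /delta_fun => /negbTE ->; rewrite rnorm0 expr0n.
apply: (@le_trans _ _ (\sum_(y <- (A `|` [fset x])%fset)
    rnorm (delta_fun x v y) ^+ 2)).
  rewrite [leRHS](big_fsetID _ (mem A))/=.
  have -> : [fset y in (A `|` [fset x])%fset | mem A y]%fset = A.
    by apply/fsetP => y; rewrite !inE/=; case: (y \in A); rewrite ?andbF.
  by rewrite lerDl sumr_ge0// => y _; rewrite sqr_ge0.
rewrite -(big_fset_incl _ (fsubsetUr A [fset x]%fset)) => [|y _ /d0//].
by rewrite big_seq_fset1 /delta_fun eqxx.
Qed.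

(* The elementary tensor of the basis vector at x with v. *)
Definition delta (x : X) (v : V) : ell2 X V := Ell2 (delta_fun_ell2 x v).

End ell2_delta.

Section operators.
Context {R : realType}.

Definition opnorm {E F : normedModType R[i]} (a : E -> F) : \bar R :=
  ereal_sup [set (rnorm (a v))%:E | v in [set v : E | rnorm v <= 1]].

Definition bounded_op {E F : normedModType R[i]} (a : E -> F) : Prop :=
  linear a /\ (opnorm a < +oo)%E.

Definition compact_op {E F : normedModType R[i]} (a : E -> F) : Prop :=
  bounded_op a /\ precompact (a @` [set v : E | rnorm v <= 1]).

Definition is_adjoint {E F : preHilbertType R} (a : E -> F) (b : F -> E) : Prop :=
  forall u v, inner (a u) v = inner u (b v).

Definition projection {E : preHilbertType R} (p : E -> E) : Prop :=
  [/\ bounded_op p, p \o p = p & is_adjoint p p].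

Definition op_closure {E : normedModType R[i]} (S : set (E -> E)) : set (E -> E) :=
  [set a | bounded_op a /\ forall e : R, 0 < e ->
    exists2 b, S b & (opnorm (a \- b)%R < e%:E)%E].

(* Adjoints are compared through is_adjoint because operators are bare
   functions; for an algebra of bounded operators closed under adjoints the
   last clause says that Phi maps the adjoint of a to the adjoint of Phi a. *)
Definition star_isomorphic {E F : preHilbertType R}
    (S : set (E -> E)) (T : set (F -> F)) : Prop :=
  exists Phi : (E -> E) -> (F -> F), set_bij S T Phi /\
    (forall a b, S a -> S b ->
      [/\ Phi (a \+ b) = Phi a \+ Phi b,
          Phi (a \o b) = Phi a \o Phi b,
          forall c : R[i], Phi (c \*: a) = c \*: Phi a &
          is_adjoint a b -> is_adjoint (Phi a) (Phi b)]).

Definition infinite_dimensional (E : lmodType R[i]) : Prop :=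
  forall n (e : 'I_n -> E), exists v : E,
    forall c : 'I_n -> R[i], v <> \sum_(i < n) c i *: e i.

Definition separable (E : topologicalType) : Prop :=
  exists2 D : set E, countable D & dense D.

End operators.

Section metric_subspace.
Context {R : realType} {X : metricType R} (A : set X).

Let sub_dist (x y : A) : R := mdist (\val x) (\val y).

Let sub_dist_ge0 (x y : A) : 0 <= sub_dist x y.
Proof. exact: mdist_ge0. Qed.

Let sub_dist_positivity (x y : A) : sub_dist x y = 0 -> x = y.
Proof. by move=> /mdist_positivity/val_inj. Qed.

Let sub_ballE (x : A) (e : R) : ball x e = [set y | sub_dist x y < e].
Proof. by rewrite -initial_ballE ballEmdist. Qed.

HB.instance Definition _ := @PseudoMetric_isMetric.Build R (A : Type)
  sub_dist sub_dist_ge0 sub_dist_positivity sub_ballE.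

Lemma mdist_subE (x y : A) : mdist x y = mdist (\val x) (\val y).
Proof. by []. Qed.

End metric_subspace.

Section coarse_geometry.
Context {R : realType}.

Definition uniformly_locally_finite (X : metricType R) : Prop :=
  forall r : R, 0 < r -> exists N : nat, forall x : X,
    ([set y | mdist x y <= r] #<= `I_N)%card.

Definition coarse_equivalence {X Y : metricType R} (f : X -> Y) : Prop :=
  [/\ forall s : R, 0 < s -> exists2 r : R, 0 < r &
        forall x y, mdist x y < s -> mdist (f x) (f y) < r,
      forall r : R, 0 < r -> exists2 s : R, 0 < s &
        forall x y, mdist x y > s -> mdist (f x) (f y) > r &
      (ereal_sup [set ereal_inf [set (mdist y (f x))%:E | x in [set: X]]
                 | y in [set: Y]] < +oo)%E].

Definition coarsely_equivalent (X Y : metricType R) : Prop :=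
  exists f : X -> Y, coarse_equivalence f.

Definition set_dist {X : metricType R} (A B : set X) : \bar R :=
  ereal_inf [set (mdist x y)%:E | x in A & y in B].

Definition sparse (X : metricType R) : Prop :=
  exists P : nat -> set X,
    [/\ \bigcup_n P n = [set: X], trivIset [set: nat] P,
        forall n, finite_set (P n) &
        forall M : R, exists N : nat, forall n m : nat, n != m ->
          (N <= n + m)%N -> (M%:E <= set_dist (P n) (P m))%E].

End coarse_geometry.

Section roe_algebras.
Context {R : realType}.

(* The matrix entry a_xy, obtained from e_yy a e_xx by identifying the ranges
   of e_xx and e_yy with V. *)
Definition entry {X : choiceType} {V : preHilbertType R}
    (a : ell2 X V -> ell2 X V) (x y : X) : V -> V :=
  fun v => a (delta x v) y.

Definition propagation {X : metricType R} {V : preHilbertType R}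
    (a : ell2 X V -> ell2 X V) : \bar R :=
  ereal_sup [set (mdist z.1 z.2)%:E | z in [set z : X * X |
    entry a z.1 z.2 <> (fun=> 0)]].

Definition finite_propagation {X : metricType R} {V : preHilbertType R}
    (a : ell2 X V -> ell2 X V) : Prop := (propagation a < +oo)%E.

Definition roe_algebra (H : preHilbertType R) (X : metricType R) :
    set (ell2 X H -> ell2 X H) :=
  op_closure [set a | [/\ bounded_op a, finite_propagation a &
    forall x y, compact_op (entry a x y)]].

Definition uniform_roe_algebra (X : metricType R) :
    set (ell2 X R[i]^o -> ell2 X R[i]^o) :=
  op_closure [set a | bounded_op a /\ finite_propagation a].

#[local] Arguments roe_algebra : clear implicits.
#[local] Arguments uniform_roe_algebra : clear implicits.

Definition uniform_roe_rigid (X : metricType R) : Prop :=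
  forall Y : metricType R, uniformly_locally_finite Y ->
    star_isomorphic (uniform_roe_algebra X) (uniform_roe_algebra Y) ->
    coarsely_equivalent X Y.

Definition ghost {X : metricType R} {H : preHilbertType R}
    (a : ell2 X H -> ell2 X H) : Prop :=
  forall e : R, 0 < e -> exists2 A : set X, finite_set A &
    forall x y, ~ A x -> ~ A y -> (opnorm (entry a x y) < e%:E)%E.

Definition only_compact_ghost_projections (H : preHilbertType R)
    (X : metricType R) : Prop :=
  forall p, roe_algebra H X p ->
    projection p -> ghost p -> compact_op p.

Definition sparse_subspaces_only_compact_ghost_projections
    (H : preHilbertType R) (X : metricType R) : Prop :=
  forall A : set X, sparse A -> only_compact_ghost_projections H A.

End roe_algebras.

Arguments roe_algebra {R} H X _.
Arguments uniform_roe_algebra {R} X _.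

(* Main.v *)
(** Let [Phi : C*_u(X) -> C*_u(Y)] be a *-isomorphism.  It maps the rank-one
    projection on [delta_x] to one on a unit vector [u x] of [l2(Y)], its inverse
    maps the projection on [delta_y] to one on a unit vector [w y] of [l2(X)],
    and [<Phi a delta_y, delta_z> = <a (w y), w z>] for suitable phases.

    By a Baire category argument the images of the projections onto [l2(A)],
    [A] a subset of [X], are uniformly approximately banded.  If [w y] had very
    small coefficients, a random choice of signs would give a diagonal unitary
    [D] such that the entries of [Phi D delta_y] in any fixed ball around [y] are
    small, and the unit vector [Phi D delta_y] could not be concentrated there.
    Hence [sup_x |w y x|] is bounded below uniformly in [y], and likewise for
    [u].  Mapping [x] to a point [f x] where [u x] has a large coefficient is
    then a coarse equivalence. *)

Require Import Defs.
From mathcomp Require Import all_boot all_order all_algebra complex.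
From mathcomp Require Import all_classical all_reals all_analysis.
From mathcomp Require Import finmap ring lra.
From mathcomp Require summability.
From HB Require Import structures.

Set Implicit Arguments.
Unset Strict Implicit.
Unset Printing Implicit Defensive.

Import Order.TTheory GRing.Theory Num.Def Num.Theory.
Import numFieldNormedType.Exports.

Local Open Scope classical_set_scope.
Local Open Scope ring_scope.

#[local] Existing Instance summability.totally_filter.

(** * Inner products and coordinates in l2 *)

Lemma rnormN {R : realType} {V : normedModType R[i]} (u : V) :
  rnorm (- u) = rnorm u.
Proof. by rewrite /rnorm normrN. Qed.

Lemma rnorm_real {R : realType} (r : R) : rnorm (r%:C%C : R[i]^o) = `|r|.
Proof. by rewrite /rnorm normc_def/= expr0n addr0 sqrtr_sqr. Qed.

Section inner_rnorm.
Context {R : realType} {V : preHilbertType R}.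
Implicit Types u v w : V.

Lemma inner_rnorm u : inner u u = (rnorm u ^+ 2)%:C%C.
Proof. by rewrite inner_norm rmorphXn/= rnormE. Qed.

Lemma inner_conj u v : inner u v = (inner v u)^*.
Proof. exact: dot_conj. Qed.

Lemma cauchy_schwarz u v : `|inner u v| <= (rnorm u * rnorm v)%:C%C.
Proof.
have := dot_CauchySchwarz inner u v.
by rewrite !inner_norm !sqrCK// rmorphM/= !rnormE.
Qed.

Lemma rnorm_inner_le u v : rnorm (inner u v : R[i]^o) <= rnorm u * rnorm v.
Proof. by rewrite -lecR rnormE; exact: cauchy_schwarz. Qed.

Lemma rnorm_inner_self u : rnorm (inner u u : R[i]^o) = rnorm u ^+ 2.
Proof. by rewrite inner_rnorm rnorm_real ger0_norm ?sqr_ge0. Qed.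

Lemma rnorm_eq0 u : (rnorm u == 0) = (u == 0).
Proof. by rewrite -(inj_eq (@complexI R)) rnormE normr_eq0. Qed.

Lemma rnorm_conj (c : R[i]^o) : rnorm (c^* : R[i]^o) = rnorm c.
Proof. by rewrite /rnorm norm_conjC. Qed.

Lemma rnorm1 : rnorm (1 : R[i]^o) = 1.
Proof. by rewrite /rnorm normr1. Qed.

Lemma parallelogram u v :
  rnorm (u + v) ^+ 2 + rnorm (u - v) ^+ 2 =
  (rnorm u ^+ 2 + rnorm v ^+ 2) *+ 2.
Proof.
apply: complexI; rewrite rmorphD rmorphMn rmorphD/= -!inner_rnorm.
by rewrite dnormB dnormD; ring.
Qed.

Lemma inner_ext u v : (forall w, inner u w = inner v w) -> u = v.
Proof.
move=> uv; apply/eqP; rewrite -subr_eq0 -rnorm_eq0.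
have : inner (u - v) (u - v) = 0 by rewrite linearBl/= uv subrr.
by rewrite inner_rnorm => /(@complexI R _ 0)/eqP; rewrite expf_eq0.
Qed.

End inner_rnorm.

Section ell2_basics.
Context {R : realType} {X : choiceType}.
Local Notation C := (R[i]^o).
Local Notation l2 := (ell2 X C).
Implicit Types (f g : l2) (x y : X).

Lemma ell2DE f g x : (f + g) x = f x + g x. Proof. by []. Qed.
Lemma ell2BE f g x : (f - g) x = f x - g x. Proof. by []. Qed.
Lemma ell2ZE (c : C) f x : (c *: f) x = c *: f x. Proof. by []. Qed.
Lemma ell20E x : (0 : l2) x = 0. Proof. by []. Qed.

Lemma ell2_sumE (I : Type) (r : seq I) (F : I -> l2) x :
  (\sum_(i <- r) F i) x = \sum_(i <- r) F i x.
Proof. by elim/big_ind2 : _ => // _ u _ v <- <-. Qed.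

Lemma inner_ell2E f g (l : C) :
  summability.partial_sum (fun x => inner (f x) (g x) : C)
    @ summability.totally --> l ->
  inner f g = l.
Proof. exact: Defs.sum_eq. Qed.

Lemma inner_delta f x (v : C) : inner f (delta x v) = f x * v^*.
Proof.
apply: inner_ell2E; apply: cvg_near_cst.
exists [fset x]%fset => // B /=.
rewrite fsub1set => xB; rewrite partial_sumE (big_fsetD1 x)//=.
rewrite /delta_fun eqxx big_seq big1 ?addr0// => y.
by rewrite !inE => /andP[/negbTE -> _]; rewrite linear0r.
Qed.

Lemma inner_basis f x : inner f (delta x (1 : C)) = f x.
Proof. by rewrite inner_delta rmorph1 mulr1. Qed.

Lemma ell2P f g : (forall x, f x = g x) -> f = g.
Proof. by move=> fg; apply: val_inj; apply/funext. Qed.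

Lemma rnorm_ell2E f : rnorm f ^+ 2 =
  sup [set \sum_(x <- A) rnorm (f x) ^+ 2 | A in [set: {fset X}]].
Proof.
apply: complexI; rewrite -inner_rnorm; apply: inner_ell2E.
have /square_summableP[M fM] := ell2_square_summable f.
rewrite (_ : (fun x => _) = (fun x => (rnorm (f x) ^+ 2)%:C%C : C)).
  by apply: (sum_cvg_ge0 _ fM) => x; rewrite sqr_ge0.
by apply/funext => x; rewrite inner_rnorm.
Qed.

Lemma has_sup_ell2 f :
  has_sup [set \sum_(x <- A) rnorm (f x) ^+ 2 | A in [set: {fset X}]].
Proof.
have /square_summableP[M fM] := ell2_square_summable f.
split; first by exists (\sum_(x <- fset0) rnorm (f x) ^+ 2), fset0.
by exists M => _ [A _ <-]; exact: fM.
Qed.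

Lemma ell2_sum_le f (A : {fset X}) :
  \sum_(x <- A) rnorm (f x) ^+ 2 <= rnorm f ^+ 2.
Proof.
by rewrite rnorm_ell2E; apply: sup_ubound; [case: (has_sup_ell2 f)|exists A].
Qed.

Lemma ell2_norm_le f (M : R) : 0 <= M ->
  (forall A : {fset X}, \sum_(x <- A) rnorm (f x) ^+ 2 <= M ^+ 2) ->
  rnorm f <= M.
Proof.
move=> M0 fM; rewrite -(@ler_pXn2r _ 2)// ?nnegrE ?rnorm_ge0//.
rewrite rnorm_ell2E; apply: ge_sup; first by case: (has_sup_ell2 f).
by move=> _ [A _ <-].
Qed.

Lemma rnorm_coord_le f x : rnorm (f x) <= rnorm f.
Proof.
rewrite -(@ler_pXn2r _ 2)// ?nnegrE ?rnorm_ge0//.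
by rewrite (le_trans _ (ell2_sum_le f [fset x]%fset))// big_seq_fset1.
Qed.

Lemma rnorm_delta x (v : C) : rnorm (delta x v) = rnorm v.
Proof.
apply/eqP; rewrite -(@eqrXn2 _ 2) ?rnorm_ge0//; apply/eqP/complexI.
by rewrite -!inner_rnorm inner_delta/= /delta_fun eqxx.
Qed.

Lemma basisE x y : delta x (1 : C) y = (y == x)%:R.
Proof. by rewrite /= /delta_fun; case: (y == x). Qed.

End ell2_basics.

(** * Bounded operators, cut-offs and adjoints *)

Section bounded_operators.
Context {R : realType} {E F : normedModType R[i]}.
Implicit Types (a b : E -> F) (M : R).

Lemma linear_opP a : linear a -> exists A : {linear E -> F}, a = A.
Proof.
move=> al; pose A : {linear E -> F} := HB.pack a
  (GRing.isLinear.Build R[i] E F *:%R a al).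
by exists A.
Qed.

Definition bounded_by M a := forall v, rnorm (a v) <= M * rnorm v.

Lemma bounded_by_ge0 M a (v : E) : v != 0 -> bounded_by M a -> 0 <= M.
Proof.
move=> v0 /(_ v); have vpos : 0 < rnorm v.
  by rewrite -ltcR rnormE normr_gt0.
by move=> /(le_trans (rnorm_ge0 _)); rewrite pmulr_lge0.
Qed.

Lemma bounded_byW M N a : M <= N -> bounded_by M a -> bounded_by N a.
Proof.
by move=> MN aM v; rewrite (le_trans (aM v))// ler_wpM2r// rnorm_ge0.
Qed.

Lemma opnorm_le_bounded_by M a : linear a ->
  (opnorm a <= M%:E)%E -> bounded_by M a.
Proof.
move=> /linear_opP[A ->] AM v.
have [->|v0] := eqVneq v 0; first by rewrite linear0 !rnorm0 mulr0.
have vpos : 0 < rnorm v by rewrite -ltcR rnormE normr_gt0.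
pose c : R[i] := ((rnorm v)^-1)%:C%C.
have cE : rnorm (c : R[i]^o) = (rnorm v)^-1.
  by rewrite rnorm_real ger0_norm// invr_ge0 ltW.
have : ((rnorm (A (c *: v)))%:E <= M%:E)%E.
  apply: le_trans AM; apply: ereal_sup_ubound; exists (c *: v) => //=.
  by rewrite rnormZ cE mulVf// gt_eqF.
by rewrite lee_fin linearZ/= rnormZ cE ler_pdivrMl// mulrC.
Qed.

Lemma bounded_by_opnorm_le M a : 0 <= M -> bounded_by M a ->
  (opnorm a <= M%:E)%E.
Proof.
move=> M0 aM; apply: ge_ereal_sup => _ [v /= v1 <-]; rewrite lee_fin.
by rewrite (le_trans (aM v))// ler_piMr.
Qed.

Lemma bounded_opP a :
  bounded_op a <-> linear a /\ exists2 M, 0 <= M & bounded_by M a.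
Proof.
split=> [[al afin]|[al [M M0 aM]]].
- split=> //; have : (opnorm a <= (fine (opnorm a))%:E)%E.
    rewrite fineK// ge0_fin_numE//; apply: ereal_sup_ubound.
    by exists 0; rewrite /= ?rnorm0//; case: (linear_opP al) => A ->;
       rewrite linear0 rnorm0.
  move=> /(opnorm_le_bounded_by al) h; exists (Num.max 0 (fine (opnorm a))).
    by rewrite le_max lexx.
  by apply: bounded_byW h; rewrite le_max lexx orbT.
- by split=> //; apply: le_lt_trans (bounded_by_opnorm_le M0 aM) _; rewrite ltry.
Qed.

Lemma linearD_op a b : linear a -> linear b -> linear (a \+ b).
Proof.
move=> /linear_opP[A ->] /linear_opP[B ->] c u v /=.
by rewrite !linearP scalerDr addrACA.
Qed.

Lemma linearB_op a b : linear a -> linear b -> linear (a \- b).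
Proof.
move=> /linear_opP[A ->] /linear_opP[B ->] c u v.
by rewrite /= !linearD !linearZ/= addrACA.
Qed.

Lemma linearZ_op (k : R[i]) a : linear a -> linear (k \*: a).
Proof.
move=> /linear_opP[A ->] c u v /=.
by rewrite linearP scalerDr !scalerA mulrC.
Qed.

Lemma bounded_byD M N a b : bounded_by M a -> bounded_by N b ->
  bounded_by (M + N) (a \+ b).
Proof.
move=> aM bN v /=; rewrite mulrDl (le_trans (rnormD _ _))//.
by rewrite lerD ?aM ?bN.
Qed.

Lemma bounded_byZ M (k : R[i]) a : bounded_by M a ->
  bounded_by (rnorm (k : R[i]^o) * M) (k \*: a).
Proof.
by move=> aM v /=; rewrite rnormZ -mulrA ler_wpM2l ?rnorm_ge0.
Qed.

End bounded_operators.

Lemma linear_comp {R : realType} {E F G : normedModType R[i]}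
  (a : F -> G) (b : E -> F) : linear a -> linear b -> linear (a \o b).
Proof.
by move=> /linear_opP[A ->] /linear_opP[B ->] c u v /=; rewrite !linearP.
Qed.

Lemma bounded_by_comp {R : realType} {E F G : normedModType R[i]} (M N : R)
    (a : F -> G) (b : E -> F) : 0 <= M ->
  bounded_by M a -> bounded_by N b -> bounded_by (M * N) (a \o b).
Proof.
move=> M0 aM bN v /=; rewrite (le_trans (aM _))//.
by rewrite -mulrA ler_wpM2l.
Qed.

Lemma bounded_by_adjoint {R : realType} {E F : preHilbertType R} (M : R)
    (a : E -> F) (b : F -> E) : 0 <= M ->
  is_adjoint a b -> bounded_by M a -> bounded_by M b.
Proof.
move=> M0 ab aM v.
have [->|bv0] := eqVneq (b v) 0; first by rewrite rnorm0 mulr_ge0// rnorm_ge0.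
have pos : 0 < rnorm (b v) by rewrite lt_neqAle eq_sym rnorm_eq0 bv0 rnorm_ge0.
rewrite -(ler_pM2l pos) -expr2 -rnorm_inner_self -ab.
rewrite (le_trans (rnorm_inner_le _ _))// mulrCA mulrA.
by rewrite ler_wpM2r ?rnorm_ge0// aM.
Qed.

(** * Restriction to a set of coordinates, and density of finite support *)

Section cut.
Context {R : realType} {X : choiceType}.
Local Notation C := (R[i]^o).
Local Notation l2 := (ell2 X C).
Implicit Types (f g : l2) (x y : X) (A B : set X).

Lemma cut_fun_ell2 A f :
  (fun x => if x \in A then f x else 0) \in @ell2_pred R X C.
Proof.
apply/asboolP/square_summableP; exists (rnorm f ^+ 2) => F.
rewrite (le_trans _ (ell2_sum_le f F))// ler_sum// => x _.
by case: ifP => // _; rewrite rnorm0 expr0n sqr_ge0.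
Qed.

Definition cut A f : l2 := Ell2 (cut_fun_ell2 A f).

Lemma cutE A f x : cut A f x = if x \in A then f x else 0.
Proof. by []. Qed.

Lemma cut_linear A : linear (cut A).
Proof.
move=> c f g; apply: ell2P => x; rewrite ell2DE ell2ZE !cutE ell2DE ell2ZE.
by case: ifP => // _; rewrite scaler0 addr0.
Qed.

Lemma cut_linE A : exists k : {linear l2 -> l2}, cut A = k.
Proof. by apply: linear_opP; exact: cut_linear. Qed.

Lemma cut_cut A B f : cut A (cut B f) = cut (A `&` B) f.
Proof. by apply: ell2P => x; rewrite !cutE in_setI; case: (x \in A). Qed.

Lemma cut_setT f : cut setT f = f.
Proof. by apply: ell2P => x; rewrite cutE in_setT. Qed.

Lemma cut_setU A B f : A `&` B = set0 -> cut (A `|` B) f = cut A f + cut B f.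
Proof.
move=> AB; apply: ell2P => x; have : (x \in A `&` B) = false.
  by rewrite AB in_set0.
rewrite ell2DE !cutE in_setI in_setU; case: (x \in A) => /=; last by rewrite add0r.
by move=> ->; rewrite addr0.
Qed.

Lemma cutD A f : f = cut A f + cut (~` A) f.
Proof. by rewrite -cut_setU ?setUCr ?setICr ?cut_setT. Qed.

Lemma inner_cut A f g : inner (cut A f) g = inner f (cut A g).
Proof.
apply: inner_ell2E; have := @ell2_inner_cvg R X C f (cut A g).
rewrite (_ : (fun x => _) = (fun x => inner (cut A f x) (g x) : C)) //.
apply/funext => x; rewrite !cutE; case: ifP => // _.
by rewrite linear0r linear0l.
Qed.

Lemma cut_pythagoras A f :
  rnorm f ^+ 2 = rnorm (cut A f) ^+ 2 + rnorm (cut (~` A) f) ^+ 2.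
Proof.
apply: complexI; rewrite rmorphD/= -!inner_rnorm {2}(cutD A f) linearD/=.
by congr (_ + _); rewrite inner_cut cut_cut setIid.
Qed.

Lemma rnorm_cut_le A f : rnorm (cut A f) <= rnorm f.
Proof.
rewrite -(@ler_pXn2r _ 2)// ?nnegrE ?rnorm_ge0//.
by rewrite [leRHS](cut_pythagoras A) lerDl sqr_ge0.
Qed.

Lemma bounded_by_cut A : bounded_by 1 (cut A).
Proof. by move=> f; rewrite mul1r rnorm_cut_le. Qed.

Lemma rnorm_cut_subset A B f : A `<=` B -> rnorm (cut A f) <= rnorm (cut B f).
Proof. by move=> /setIidl <-; rewrite -cut_cut rnorm_cut_le. Qed.

Definition comb (F : seq X) (c : X -> C) : l2 :=
  \sum_(x <- F) c x *: delta x (1 : C).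

Lemma combE (F : {fset X}) c y : comb F c y = if y \in F then c y else 0.
Proof.
rewrite /comb ell2_sumE; case: ifPn => [yF|yF].
  rewrite (big_fsetD1 y)// ell2ZE basisE eqxx [_ *: _]mulr1.
  rewrite big_seq big1 => [|x]; first by rewrite /= addr0.
  rewrite !inE => /andP[xy _].
  by rewrite ell2ZE basisE eq_sym (negbTE xy) scaler0.
rewrite big_seq big1// => x xF; rewrite ell2ZE basisE.
by case: eqVneq => [yx|]; [rewrite yx xF in yF|rewrite scaler0].
Qed.

Lemma rnorm_comb (F : {fset X}) c :
  rnorm (comb F c) ^+ 2 = \sum_(x <- F) rnorm (c x) ^+ 2.
Proof.
apply: complexI; rewrite -inner_rnorm rmorph_sum/=.
apply: inner_ell2E; apply: cvg_near_cst; exists F => // B /=.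
move=> FB; rewrite partial_sumE -(big_fset_incl _ FB) /=.
  by rewrite big_seq [RHS]big_seq; apply: eq_bigr => x xF;
    rewrite !combE xF -inner_rnorm.
by move=> x xB xF; rewrite !combE (negbTE xF) linear0r.
Qed.

Lemma cut_fset (F : {fset X}) f : cut [set` F] f = comb F f.
Proof.
apply: ell2P => y; rewrite cutE combE.
rewrite (_ : (y \in [set` F]) = (y \in F))//.
by apply/idP/idP => [/set_mem//|yF]; exact/mem_set.
Qed.

Lemma cut_set1 x f : cut [set x] f = f x *: delta x (1 : C).
Proof.
apply: ell2P => y; rewrite cutE ell2ZE basisE.
rewrite (_ : (y \in [set x]) = (y == x)); last first.
  by apply/idP/eqP => [/set_mem//|->]; exact/mem_set.
by case: eqVneq => [->|]; rewrite ?scaler0// [RHS]mulr1.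
Qed.

(** The finite partial sums approach the squared norm, and Pythagoras turns the missing amount into
    the squared norm of the tail. *)
Lemma small_tail f (e : R) : 0 < e ->
  exists F : {fset X}, rnorm (cut (~` [set` F]) f) < e.
Proof.
move=> e0; have e20 : 0 < e ^+ 2 by rewrite exprn_gt0.
have [_ [F _ <-]] := sup_adherent e20 (has_sup_ell2 f).
rewrite -rnorm_ell2E => h; exists F.
rewrite -(@ltr_pXn2r _ 2)// ?nnegrE ?rnorm_ge0 ?ltW//.
move: h; rewrite (cut_pythagoras [set` F]) cut_fset rnorm_comb.
set t := rnorm _ ^+ 2; set S := \sum_(_ <- _) _; lra.
Qed.

(** Density argument: [phi] kills every finite cut-off of [f] term by term, and boundedness makes
    its value on the tail arbitrarily small. *)
Lemma functional_eq0 (phi : l2 -> C) (M : R) f : linear phi ->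
  bounded_by M phi ->
  (forall x, f x != 0 -> phi (delta x (1 : C)) = 0) -> phi f = 0.
Proof.
move=> /linear_opP[p ->] pM f0; have [->|fn0] := eqVneq f 0.
  by rewrite linear0.
have M0 := bounded_by_ge0 fn0 pM.
apply/eqP; rewrite -rnorm_eq0 eq_le rnorm_ge0 andbT.
apply/ler_addgt0Pl => e e0; rewrite addr0.
(* The divisor is [M + 1] because [M] may be 0. *)
have [F Fe] := small_tail f (divr_gt0 e0 (ltr_wpDl M0 ltr01)).
rewrite (cutD [set` F] f) linearD cut_fset /comb linear_sum/=.
rewrite big1 ?add0r => [|x _]; last first.
  rewrite linearZ/=; have [->|/f0 ->] := eqVneq (f x) 0.
    by rewrite scale0r.
  by rewrite scaler0.
rewrite (le_trans (pM _))//; move: Fe; rewrite ltr_pdivlMr ?ltr_wpDl//.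
by move=> /ltW; apply: le_trans; rewrite mulrC ler_wpM2l ?rnorm_ge0// lerDl.
Qed.

Lemma coord_eq0 Y (b : l2 -> ell2 Y C) (M : R) f (y : Y) : linear b ->
  bounded_by M b ->
  (forall x, f x != 0 -> b (delta x (1 : C)) y = 0) -> b f y = 0.
Proof.
move=> bl bM; apply: (@functional_eq0 (fun g => b g y) M).
  by move: bl => /linear_opP[B ->] c u v; rewrite linearP.
by move=> v; rewrite (le_trans (rnorm_coord_le _ _)).
Qed.

End cut.

(** * Construction of adjoints from matrix entries *)

Section adjoint.
Context {R : realType} {X Y : choiceType}.
Local Notation C := (R[i]^o).
Context (a : ell2 X C -> ell2 Y C) (M : R).
Context (M0 : 0 <= M) (al : linear a) (aM : bounded_by M a).

(** Let [h] be the finite combination of basis vectors whose coefficients are the proposed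
    coordinates. Then [inner g (a h)] is the squared norm of [h], so Cauchy-Schwarz bounds the norm
    of [h] by [M * rnorm g], independently of the finite set. *)
Lemma adj_fun_ell2 (g : ell2 Y C) :
  (fun x => inner g (a (delta x (1 : C))) : C) \in @ell2_pred R X C.
Proof.
case: (linear_opP al) aM => A -> AM.
apply/asboolP/square_summableP; exists ((M * rnorm g) ^+ 2) => F.
pose c x : C := inner g (A (delta x (1 : C))); set S := \sum_(_ <- _) _.
have SE : S = rnorm (comb F c) ^+ 2 by rewrite rnorm_comb.
have SE' : inner g (A (comb F c)) = S%:C%C.
  rewrite /comb linear_sum linear_sumr /S rmorph_sum; apply: eq_bigr => x _.
  by rewrite linearZ/= linearZr_LR/= -inner_rnorm mulrC.
have := rnorm_inner_le g (A (comb F c)).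
have S0 : 0 <= S by rewrite SE sqr_ge0.
rewrite SE' rnorm_real ger0_norm// => h.
have {}h : S <= rnorm g * (M * rnorm (comb F c)).
  by rewrite (le_trans h)// ler_wpM2l// rnorm_ge0.
rewrite SE lerXn2r ?nnegrE ?mulr_ge0 ?rnorm_ge0//.
have [->|c0] := eqVneq (rnorm (comb F c)) 0; first by rewrite mulr_ge0 ?rnorm_ge0.
have pos : 0 < rnorm (comb F c) by rewrite lt_neqAle eq_sym c0 rnorm_ge0.
rewrite -(ler_pM2r pos) -expr2 -SE (le_trans h)//.
by rewrite mulrCA mulrA.
Qed.

Definition adj (g : ell2 Y C) : ell2 X C := Ell2 (adj_fun_ell2 g).

Lemma adj_linear : linear adj.
Proof. by move=> c f g; apply: ell2P => x; rewrite /= linearPl. Qed.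

(** For fixed [g] the difference of the two sides is a bounded linear functional of [f] that
    vanishes on the basis. *)
Lemma is_adjoint_adj : is_adjoint a adj.
Proof.
move=> f g; apply/eqP; rewrite -subr_eq0; apply/eqP.
pose phi (h : ell2 X C) : C := inner (a h) g - inner h (adj g).
rewrite -[LHS]/(phi f); apply: (@functional_eq0 _ _ phi
  (M * rnorm g + rnorm (adj g))).
- case: (linear_opP al) => A Aa; rewrite /phi Aa => c u v.
  rewrite linearP !linearPl/=; rewrite /GRing.scale/=; ring.
- move=> v; rewrite (le_trans (rnormD _ _))// rnormN mulrDl lerD//.
    rewrite (le_trans (rnorm_inner_le _ _))// mulrAC.
    by rewrite ler_wpM2r ?rnorm_ge0.
  by rewrite (le_trans (rnorm_inner_le _ _))// mulrC.
- move=> x _; apply/eqP; rewrite /phi subr_eq0 [inner (delta _ _) _]inner_conj.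
  by rewrite inner_basis /= -inner_conj.
Qed.

Lemma bounded_by_adj : bounded_by M adj.
Proof. exact: (bounded_by_adjoint M0 is_adjoint_adj). Qed.

End adjoint.

(** * The uniform Roe algebra *)

Section uniform_roe.
Context {R : realType} {X : metricType R}.
Local Notation C := (R[i]^o).
Local Notation l2 := (ell2 X C).
Implicit Types (a b : l2 -> l2) (x y z : X).

Definition propagation_le (r : R) a :=
  forall x y, r < mdist x y -> a (delta x (1 : C)) y = 0.

(** The fibres are scalar, so by linearity an entry vanishes as soon as its value at 1 does. *)
Lemma finite_propagationP a : linear a ->
  finite_propagation a <-> exists2 r, 0 <= r & propagation_le r a.
Proof.
move=> /linear_opP[A ->].
have entryE x v : A (delta x v) = v *: A (delta x (1 : C)).
  rewrite -linearZ; congr (A _); apply: ell2P => y.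
  by rewrite ell2ZE basisE /= /delta_fun; case: (y == x);
    rewrite ?scaler0// [RHS]mulr1.
split=> [fin|[r r0 Ar]].
(* When all entries vanish the supremum is -oo; the maximum with 0 yields a nonnegative radius in
   every case. *)
- pose p := Num.max 0 (fine (propagation A)); exists p.
    by rewrite le_max lexx.
  move=> x y pxy; apply: contrapT => Axy.
  have : ((mdist x y)%:E <= propagation A)%E.
    apply: ereal_sup_ubound; exists (x, y) => //=.
    by move=> /(congr1 (fun f => f (1 : C))).
  move: fin; rewrite /finite_propagation /p in pxy *.
  case: (propagation A) pxy => [s /= pxy _| //|//].
  rewrite lee_fin leNgt => /negP; apply; apply: le_lt_trans pxy.
  by rewrite le_max lexx orbT.
- apply: (@le_lt_trans _ _ r%:E); last by rewrite ltry.
  apply: ge_ereal_sup => _ [[x y] /= Axy <-]; rewrite lee_fin leNgt.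
  apply/negP => /Ar h; apply: Axy; apply/funext => v.
  by rewrite /entry entryE ell2ZE h scaler0.
Qed.

Definition banded (b : l2 -> l2) : Prop :=
  [/\ linear b, exists2 M, 0 <= M & bounded_by M b
    & exists2 r, 0 <= r & propagation_le r b].

Lemma uniform_roeP a : uniform_roe_algebra X a <->
  [/\ linear a, exists2 M, 0 <= M & bounded_by M a &
      forall e, 0 < e -> exists2 b, banded b & bounded_by e (a \- b)].
Proof.
split=> [[/bounded_opP[al aM] ae]|[al aM ae]].
- split=> // e e0; have [b [/bounded_opP[bl bM] bp] abe] := ae _ e0.
  exists b; first by split=> //; apply/(finite_propagationP bl).
  by apply: opnorm_le_bounded_by (ltW abe); exact: linearB_op.
- split; first exact/bounded_opP.
  (* Half the tolerance, since [bounded_by] only gives a weak inequality and the closure asks for a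
     strict one. *)
  move=> e e0; have e20 : 0 < e / 2 by rewrite divr_gt0.
  have [b [bl bM br] abe] := ae _ e20; exists b.
    by split; [exact/bounded_opP|exact/(finite_propagationP bl)].
  apply: le_lt_trans (bounded_by_opnorm_le (ltW e20) abe) _.
  by rewrite lte_fin ltr_pdivrMr// ltr_pMr// ltr1n.
Qed.

Lemma uniform_roe_banded a : banded a -> uniform_roe_algebra X a.
Proof.
move=> ab; have [al aM _] := ab; apply/uniform_roeP; split=> // e e0.
by exists a => // v; rewrite /= subrr rnorm0 mulr_ge0 ?rnorm_ge0// ltW.
Qed.

Lemma bandedD a b : banded a -> banded b -> banded (a \+ b).
Proof.
move=> [al [M M0 aM] [r r0 ar]] [bl [N N0 bN] [s s0 bs]]; split.
- exact: linearD_op.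
- by exists (M + N); [rewrite addr_ge0|exact: bounded_byD].
- exists (r + s); first by rewrite addr_ge0.
  move=> x y xy; rewrite -[LHS]/(a (delta x (1 : C)) y + b (delta x (1 : C)) y).
  by rewrite ar ?bs ?addr0//; apply: le_lt_trans xy; rewrite ?lerDl ?lerDr.
Qed.

Lemma bandedZ (c : R[i]) a : banded a -> banded (c \*: a).
Proof.
move=> [al [M M0 aM] [r r0 ar]]; split.
- exact: linearZ_op.
- by exists (rnorm (c : C) * M); [rewrite mulr_ge0 ?rnorm_ge0|exact: bounded_byZ].
- by exists r => // x y xy;
    rewrite -[LHS]/(c *: a (delta x (1 : C)) y) ar// scaler0.
Qed.

Lemma banded_comp a b : banded a -> banded b -> banded (a \o b).
Proof.
move=> [al [M M0 aM] [r r0 ar]] [bl [N N0 bN] [s s0 bs]]; split.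
- exact: linear_comp.
- by exists (M * N); [rewrite mulr_ge0|exact: bounded_by_comp].
- exists (r + s); first by rewrite addr_ge0.
  move=> x y xy; apply: (coord_eq0 al aM) => z bxz; apply: ar.
  have xz : mdist x z <= s.
    by rewrite leNgt; apply: contra_neqN bxz; exact: bs.
  by have := metric_triangle x z y; lra.
Qed.

Lemma banded_adj a : banded a -> exists2 b, banded b & is_adjoint a b.
Proof.
move=> [al [M M0 aM] [r r0 ar]]; exists (adj M0 al aM).
  split; first exact: adj_linear.
  - by exists M => //; exact: bounded_by_adj.
  - exists r => // x y xy; rewrite /= inner_conj inner_basis ar ?rmorph0//.
    by rewrite metric_sym.
exact: is_adjoint_adj.
Qed.

Lemma uniform_roeD a b : uniform_roe_algebra X a -> uniform_roe_algebra X b ->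
  uniform_roe_algebra X (a \+ b).
Proof.
move=> /uniform_roeP[al [M M0 aM] ae] /uniform_roeP[bl [N N0 bN] be].
apply/uniform_roeP; split.
- exact: linearD_op.
- by exists (M + N); [rewrite addr_ge0|exact: bounded_byD].
- move=> e e0; have e20 : 0 < e / 2 by rewrite divr_gt0.
  have [a' a'b aa'] := ae _ e20; have [b' b'b bb'] := be _ e20.
  exists (a' \+ b'); first exact: bandedD.
  move=> v; have := bounded_byD aa' bb' v.
  by rewrite -splitr /= opprD addrACA.
Qed.

Lemma uniform_roeZ (c : R[i]) a : uniform_roe_algebra X a ->
  uniform_roe_algebra X (c \*: a).
Proof.
move=> /uniform_roeP[al [M M0 aM] ae]; apply/uniform_roeP; split.
- exact: linearZ_op.
- by exists (rnorm (c : C) * M); [rewrite mulr_ge0 ?rnorm_ge0|exact: bounded_byZ].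
- move=> e e0; have c0 : 0 < rnorm (c : C) + 1 by rewrite ltr_wpDl ?rnorm_ge0.
  have [a' a'b aa'] := ae _ (divr_gt0 e0 c0).
  exists (c \*: a'); first exact: bandedZ.
  move=> v; rewrite /= -scalerBr rnormZ.
  rewrite (le_trans (ler_wpM2l (rnorm_ge0 _) (aa' v)))// mulrA.
  rewrite ler_wpM2r ?rnorm_ge0// mulrCA ler_piMr ?(ltW e0)//.
  by rewrite ler_pdivrMr// mul1r lerDl.
Qed.

Lemma uniform_roe_comp a b : uniform_roe_algebra X a ->
  uniform_roe_algebra X b -> uniform_roe_algebra X (a \o b).
Proof.
move=> /uniform_roeP[al [M M0 aM] ae] /uniform_roeP[bl [N N0 bN] be].
apply/uniform_roeP; split.
- exact: linear_comp.
- by exists (M * N); [rewrite mulr_ge0|exact: bounded_by_comp].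
- move=> e e0; have e20 : 0 < e / 2 by rewrite divr_gt0.
  have N1 : 0 < N + 1 by rewrite ltr_wpDl.
  have [a' a'b aa'] := ae _ (divr_gt0 e20 N1).
  (* The approximant of [b] is chosen last: the error is [(a - a') b + a' (b - b')], so its
     tolerance depends on the bound [K] of [a']. *)
  have [a'l [K K0 a'K] _] := a'b.
  have K1 : 0 < K + 1 by rewrite ltr_wpDl.
  have [b' b'b bb'] := be _ (divr_gt0 e20 K1).
  exists (a' \o b'); first exact: banded_comp.
  move=> v; have -> : ((a \o b) \- (a' \o b')) v = (a \- a') (b v) + a' ((b \- b') v).
    by move: a'l => /linear_opP[A' ->] /=; rewrite linearB/= addrA subrK.
  rewrite (le_trans (rnormD _ _))// [e]splitr mulrDl lerD//.
    rewrite (le_trans (aa' _))// -mulrA ler_pM2l//.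
    rewrite mulrC ler_pdivrMr// mulrC mulrDl mul1r ler_wpDr ?rnorm_ge0//.
  rewrite (le_trans (a'K _))// (le_trans (ler_wpM2l K0 (bb' v)))//.
  rewrite mulrA ler_wpM2r ?rnorm_ge0// mulrCA ler_piMr ?(ltW e20)//.
  by rewrite ler_pdivrMr// mul1r lerDl.
Qed.

(** Passing to adjoints preserves both norm bounds and propagation bounds, so adjoints of banded
    approximants approximate the adjoint. *)
Lemma uniform_roe_adj a : uniform_roe_algebra X a ->
  exists2 b, uniform_roe_algebra X b & is_adjoint a b.
Proof.
move=> /uniform_roeP[al [M M0 aM] ae]; exists (adj M0 al aM); last first.
  exact: is_adjoint_adj.
apply/uniform_roeP; split; first exact: adj_linear.
- by exists M => //; exact: bounded_by_adj.
- move=> e e0; have [b bb be] := ae _ e0; have [b' b'b bb'] := banded_adj bb.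
  exists b' => //; apply: (bounded_by_adjoint (ltW e0) _ be) => u v.
  by rewrite /= linearBl linearBr/= bb' (is_adjoint_adj M0 al aM).
Qed.

Lemma banded_cut (A : set X) : banded (cut A).
Proof.
split; first exact: cut_linear.
- by exists 1 => //; exact: bounded_by_cut.
- exists 0 => // x y; rewrite mdist_gt0 eq_sym cutE basisE => /negbTE ->.
  by case: ifP.
Qed.

Lemma uniform_roe_cut (A : set X) : uniform_roe_algebra X (cut A).
Proof. exact/uniform_roe_banded/banded_cut. Qed.

Definition matrix_unit x y : l2 -> l2 := fun f => f y *: delta x (1 : C).

Lemma matrix_unit_diag x : matrix_unit x x = cut [set x].
Proof. by apply/funext => f; rewrite cut_set1. Qed.

Lemma banded_matrix_unit x y : banded (matrix_unit x y).
Proof.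
split.
- by move=> c f g; rewrite /matrix_unit ell2DE ell2ZE scalerDl scalerA.
- exists 1 => // f; rewrite mul1r rnormZ rnorm_delta rnorm1 mulr1.
  exact: rnorm_coord_le.
- exists (mdist y x); first exact: mdist_ge0.
  move=> z t; rewrite /matrix_unit basisE ell2ZE basisE.
  by have [->|] := eqVneq t x; have [->|] := eqVneq y z;
    rewrite ?ltxx// ?scale0r ?scaler0.
Qed.

Lemma uniform_roe_matrix_unit x y : uniform_roe_algebra X (matrix_unit x y).
Proof. exact/uniform_roe_banded/banded_matrix_unit. Qed.

Lemma matrix_unit_comp x y z :
  matrix_unit x y \o matrix_unit y z = matrix_unit x z.
Proof.
apply/funext => f; rewrite -[LHS]/((f z *: delta y (1 : C)) y *: delta x (1 : C)).
by rewrite ell2ZE basisE eqxx [_ *: 1]mulr1.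
Qed.

(** This expresses a matrix entry by algebra operations alone, which is what lets a *-isomorphism
    see it. *)
Lemma matrix_unit_sandwich a x y z : linear a ->
  matrix_unit x y \o a \o matrix_unit z x = a (delta z (1 : C)) y \*: matrix_unit x x.
Proof.
move=> /linear_opP[A ->]; apply/funext => f.
rewrite -[LHS]/(A (f x *: delta z (1 : C)) y *: delta x (1 : C)).
rewrite -[RHS]/(A (delta z (1 : C)) y *: (f x *: delta x (1 : C))).
by rewrite linearZ ell2ZE scalerA [_ * f x]mulrC.
Qed.

Lemma is_adjoint_matrix_unit x y :
  is_adjoint (matrix_unit x y) (matrix_unit y x).
Proof.
move=> f g; rewrite /matrix_unit linearZl_LR linearZr_LR/=.
by rewrite inner_basis inner_conj inner_basis mulrC.
Qed.

End uniform_roe.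

(** * Spatial implementation of *-isomorphisms *)

Section star_isomorphism.
Context {R : realType}.
Local Notation C := (R[i]^o).
Local Notation l2 X := (ell2 X C).

(** Only [Psi (Phi a) = a] is recorded. An isomorphism is this record together with the one with
    [Phi] and [Psi] exchanged, so each later lemma can be used in both directions. *)
Record star_iso_inverse (X Y : metricType R) (Phi : (l2 X -> l2 X) -> (l2 Y -> l2 Y))
    (Psi : (l2 Y -> l2 Y) -> (l2 X -> l2 X)) : Prop := StarIsoInverse {
  star_iso_mem : forall a, uniform_roe_algebra X a -> uniform_roe_algebra Y (Phi a);
  star_isoK : forall a, uniform_roe_algebra X a -> Psi (Phi a) = a;
  star_isoD : forall a b, uniform_roe_algebra X a -> uniform_roe_algebra X b ->
    Phi (a \+ b) = Phi a \+ Phi b;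
  star_isoM : forall a b, uniform_roe_algebra X a -> uniform_roe_algebra X b ->
    Phi (a \o b) = Phi a \o Phi b;
  star_isoZ : forall (c : R[i]) a, uniform_roe_algebra X a ->
    Phi (c \*: a) = c \*: Phi a;
  star_iso_adj : forall a b, uniform_roe_algebra X a -> uniform_roe_algebra X b ->
    is_adjoint a b -> is_adjoint (Phi a) (Phi b) }.

Lemma adjoint_unique (E F : preHilbertType R) (a : E -> F) (b c : F -> E) :
  is_adjoint a b -> is_adjoint a c -> b = c.
Proof.
move=> ab ac; apply/funext => v; apply: inner_ext => w.
by rewrite inner_conj -ab ac -inner_conj.
Qed.

Lemma star_isomorphic_inverse (X Y : metricType R) :
  star_isomorphic (uniform_roe_algebra X) (uniform_roe_algebra Y) ->
  exists Phi Psi, @star_iso_inverse X Y Phi Psi /\ star_iso_inverse Psi Phi.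
Proof.
move=> [Phi [[PhiST Phi_inj Phi_surj] Phi_hom]].
have [Psi PsiP] : {Psi & forall b, uniform_roe_algebra Y b ->
    uniform_roe_algebra X (Psi b) /\ Phi (Psi b) = b}.
  apply: (@choice _ _ (fun b a => uniform_roe_algebra Y b ->
    uniform_roe_algebra X a /\ Phi a = b)) => b.
  have [/Phi_surj[a Sa <-]|nTb] := pselect (uniform_roe_algebra Y b).
    by exists a.
  by exists (fun=> 0).
have PhiK a : uniform_roe_algebra X a -> Psi (Phi a) = a.
  move=> Sa; have [SPa PhiPa] := PsiP _ (PhiST _ Sa).
  by apply: Phi_inj => //; exact/mem_set.
exists Phi, Psi; split; split.
- exact: PhiST.
- exact: PhiK.
- by move=> a b Sa Sb; have [] := Phi_hom _ _ Sa Sb.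
- by move=> a b Sa Sb; have [] := Phi_hom _ _ Sa Sb.
- by move=> c a Sa; have [_ _ ->] := Phi_hom _ _ Sa Sa.
- by move=> a b Sa Sb; have [] := Phi_hom _ _ Sa Sb.
- by move=> b /PsiP[].
- by move=> b /PsiP[].
- move=> b c /PsiP[Sb eb] /PsiP[Sc ec].
  have [h _ _ _] := Phi_hom _ _ Sb Sc.
  transitivity (Psi (Phi (Psi b \+ Psi c))); first by rewrite h eb ec.
  exact: PhiK (uniform_roeD Sb Sc).
- move=> b c /PsiP[Sb eb] /PsiP[Sc ec].
  have [_ h _ _] := Phi_hom _ _ Sb Sc.
  transitivity (Psi (Phi (Psi b \o Psi c))); first by rewrite h eb ec.
  exact: PhiK (uniform_roe_comp Sb Sc).
- move=> k b /PsiP[Sb eb].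
  have [_ _ h _] := Phi_hom _ _ Sb Sb.
  transitivity (Psi (Phi (k \*: Psi b))); first by rewrite h eb.
  exact: PhiK (uniform_roeZ k Sb).
(* An adjoint [a] of [Psi b] exists inside the algebra. Its image is an adjoint of [b], hence equals
   [c] by uniqueness, so [a] is [Psi c]. *)
- move=> b c /PsiP[Sb eb] /PsiP[Sc ec] bc.
  have [a Sa ba] := uniform_roe_adj Sb.
  have [_ _ _ /(_ ba)] := Phi_hom _ _ Sb Sa.
  rewrite eb => /(adjoint_unique bc) ca.
  by rewrite ca (PhiK _ Sa).
Qed.

(** * Unit vectors implementing the isomorphism *)

Section implementation.
Context {X Y : metricType R} {Phi : (l2 X -> l2 X) -> (l2 Y -> l2 Y)}
  {Psi : (l2 Y -> l2 Y) -> (l2 X -> l2 X)}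
  (PhiP : star_iso_inverse Phi Psi) (PsiP : star_iso_inverse Psi Phi).

Lemma star_iso_linear a : uniform_roe_algebra X a -> linear (Phi a).
Proof. by move=> /(star_iso_mem PhiP)/uniform_roeP[]. Qed.

Lemma star_iso_sandwich b x y z eta : uniform_roe_algebra Y b ->
  Phi (matrix_unit x y) (b (Phi (matrix_unit z x) eta)) =
  Psi b (delta z (1 : C)) y *: Phi (matrix_unit x x) eta.
Proof.
move=> Sb; have Sa := star_iso_mem PsiP Sb.
have S x' x'' := uniform_roe_matrix_unit (X := X) x' x''.
have al : linear (Psi b) by case/uniform_roeP: Sa.
transitivity (Phi (matrix_unit x y \o Psi b \o matrix_unit z x) eta).
  rewrite (star_isoM PhiP (uniform_roe_comp (S x y) Sa) (S z x)).
  by rewrite (star_isoM PhiP (S x y) Sa) (star_isoK PsiP Sb).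
by rewrite (matrix_unit_sandwich x y z al) (star_isoZ PhiP _ (S x x)).
Qed.

(* The corner of the matrix unit at x is one-dimensional, and this property
   passes to its image p, so p e_zz p is a multiple of p for every z. *)
Lemma rank_one_image x : exists2 zeta : l2 Y, rnorm zeta = 1 &
  forall eta, Phi (matrix_unit x x) eta = inner eta zeta *: zeta.
Proof.
have Sx := uniform_roe_matrix_unit x x.
set p := Phi (matrix_unit x x).
have pl : linear p := star_iso_linear Sx.
have psa : is_adjoint p p.
  exact: (star_iso_adj PhiP Sx Sx (is_adjoint_matrix_unit x x)).
have pp eta : p (p eta) = p eta.
  by rewrite -[LHS]/((p \o p) eta) /p -(star_isoM PhiP Sx Sx) matrix_unit_comp.
have inner_p eta z : inner eta (p (delta z (1 : C))) = p eta z.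
  by rewrite -psa inner_basis.
(* If all these columns vanished, [p] would be 0, and applying [Psi] would make the matrix unit
   0. *)
have [z pz0] : exists z, p (delta z (1 : C)) != 0.
  apply: contrapT => /forallNP p0.
  have {}p0 : p = fun=> 0.
    apply/funext => eta; apply: ell2P => z.
    by rewrite -inner_p; move/negP/negPn/eqP: (p0 z) => ->; rewrite linear0r.
  have S0 := uniform_roeZ 0 Sx.
  have : Psi (Phi (0 \*: matrix_unit x x)) = Psi (Phi (matrix_unit x x)).
    congr Psi; rewrite (star_isoZ PhiP)// -/p p0.
    by apply/funext => eta; exact: scaler0.
  rewrite !(star_isoK PhiP)//.
  move=> /(congr1 (fun f : l2 X -> l2 X => f (delta x (1 : C)) x)).
  rewrite -[LHS]/((0 *: matrix_unit x x (delta x (1 : C))) x) scale0r.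
  rewrite /matrix_unit ell20E !(ell2ZE, basisE) eqxx scale1r => /esym/eqP.
  by rewrite oner_eq0.
set xi := p (delta z (1 : C)) in pz0.
have Sz := uniform_roe_matrix_unit z z.
(* The left side is [p] applied to the cut-off of [p eta] at [z]. Taking [eta] to be the basis
   vector at [z] then identifies [l] as the squared norm of [xi]. *)
have [l lP] : exists l : R[i], forall eta, p eta z *: xi = l *: p eta.
  exists (Psi (matrix_unit z z) (delta x (1 : C)) x) => eta.
  rewrite -(star_iso_sandwich x x x eta Sz) -/p.
  by case: (linear_opP pl) @xi pz0 => q -> /= _; rewrite linearZ.
have xiz : xi z = (rnorm xi ^+ 2)%:C%C.
  by rewrite -inner_rnorm /xi -psa inner_basis pp.
have xi0 : (rnorm xi ^+ 2)%:C%C != 0 :> R[i].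
  by rewrite -inner_rnorm inner_norm expf_eq0/= normr_eq0.
have lE : l = (rnorm xi ^+ 2)%:C%C.
  have := lP (delta z (1 : C)); rewrite -/xi xiz => /eqP.
  by rewrite -subr_eq0 -scalerBl scaler_eq0 (negbTE pz0) orbF subr_eq0 => /eqP.
have rxi0 : 0 < rnorm xi by rewrite lt_neqAle eq_sym rnorm_eq0 pz0 rnorm_ge0.
pose c := ((rnorm xi)^-1)%:C%C : R[i].
have cc : c * c^* = ((rnorm xi ^+ 2)%:C%C)^-1.
  rewrite /c -normCK ger0_norm ?ler0c ?invr_ge0 ?ltW//.
  by rewrite -rmorphXn -fmorphV exprVn.
exists (c *: xi).
  by rewrite rnormZ rnorm_real ger0_norm ?invr_ge0 ?mulVf ?ltW// gt_eqF.
move=> eta; rewrite linearZr_LR/= inner_p scalerA mulrAC [c^* * c]mulrC cc.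
by rewrite -scalerA lP lE scalerA mulVf ?scale1r.
Qed.

(** One unit vector is chosen at a base point [x0] and carried to every other [x] by the image of
    the matrix unit from [x0] to [x]. This fixes all phases coherently, so the entry formula holds
    exactly. *)
Lemma implementing_vectors : exists u : X -> l2 Y,
  [/\ forall x, rnorm (u x) = 1,
      forall x eta, Phi (matrix_unit x x) eta = inner eta (u x) *: u x &
      forall b, uniform_roe_algebra Y b -> forall x x',
        Psi b (delta x (1 : C)) x' = inner (b (u x)) (u x')].
Proof.
(* Without a base point [X] is empty and the claims are vacuous. *)
have [[x0]|noX] := pselect (inhabited X); last first.
  by exists (fun=> 0); split=> [x|x|b _ x]; case: noX.
have [zeta zeta1 zetaP] := rank_one_image x0.
have S x x' := uniform_roe_matrix_unit (X := X) x x'.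
have PhiE x x' x'' eta : Phi (matrix_unit x x') (Phi (matrix_unit x' x'') eta) =
    Phi (matrix_unit x x'') eta.
  rewrite -[LHS]/((Phi (matrix_unit x x') \o Phi (matrix_unit x' x'')) eta).
  by rewrite -(star_isoM PhiP)// matrix_unit_comp.
have Phi_adj x x' eta xi : inner (Phi (matrix_unit x x') eta) xi =
    inner eta (Phi (matrix_unit x' x) xi).
  exact: (star_iso_adj PhiP (S x x') (S x' x) (is_adjoint_matrix_unit x x') eta xi).
have zeta_zeta : inner zeta zeta = 1 by rewrite inner_rnorm zeta1 expr1n.
exists (fun x => Phi (matrix_unit x x0) zeta).
have uu x : inner (Phi (matrix_unit x x0) zeta) (Phi (matrix_unit x x0) zeta) = 1.
  by rewrite Phi_adj PhiE zetaP zeta_zeta scale1r zeta_zeta.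
split=> [x|x eta|b Sb x x'].
- apply/eqP; rewrite -(@eqrXn2 _ 2)// ?rnorm_ge0// expr1n.
  by rewrite -rnorm_inner_self uu rnorm1.
- rewrite -(PhiE x x0 x) -(PhiE x0 x0 x) zetaP -Phi_adj.
  by have := star_iso_linear (S x x0) => /linear_opP[q ->]; rewrite linearZ.
- rewrite -Phi_adj (star_iso_sandwich _ _ _ _ Sb) zetaP zeta_zeta scale1r.
  by rewrite linearZl_LR/= zeta_zeta mulr1.
Qed.

End implementation.
End star_isomorphism.

(** * Uniform near-diagonality *)

Section equi_approximation.
Context {R : realType} {X Y : metricType R}.
Local Notation C := (R[i]^o).
Local Notation l2 X := (ell2 X C).

Lemma rnorm_le_coord (Z : choiceType) (f g : l2 Z) :
  (forall x, rnorm (f x) <= rnorm (g x)) -> rnorm f <= rnorm g.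
Proof.
move=> fg; apply: ell2_norm_le; first exact: rnorm_ge0.
move=> F; rewrite (le_trans _ (ell2_sum_le g F))// ler_sum// => x _.
by rewrite lerXn2r ?nnegrE ?rnorm_ge0.
Qed.

Definition far (r : R) (y : Y) : set Y := [set z | r < mdist y z].

(** A columnwise condition, implied by approximation within [e] in norm by an operator of
    propagation at most [r]. *)
Definition near_diagonal (a : l2 Y -> l2 Y) (e r : R) : Prop :=
  forall y, rnorm (cut (far r y) (a (delta y (1 : C)))) <= e.

Lemma near_diagonalW a (e e' r r' : R) : e <= e' -> r <= r' ->
  near_diagonal a e r -> near_diagonal a e' r'.
Proof.
move=> ee' rr' aer y; apply: le_trans ee'; apply: le_trans (aer y).
by apply: rnorm_cut_subset => z; rewrite /far /= => rz; exact: le_lt_trans rz.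
Qed.

Lemma near_diagonal_uniform_roe a (e : R) : uniform_roe_algebra Y a -> 0 < e ->
  exists2 r : R, 0 <= r & near_diagonal a e r.
Proof.
move=> /uniform_roeP[al _ ae] e0; have [b [bl _ [r r0 br]] abe] := ae _ e0.
exists r => // y.
have -> : cut (far r y) (a (delta y (1 : C))) =
    cut (far r y) ((a \- b) (delta y (1 : C))).
  apply: ell2P => z; rewrite !cutE; case: ifPn => // /set_mem/br byz.
  by rewrite -[RHS]/(a (delta y (1 : C)) z - b (delta y (1 : C)) z) byz subr0.
rewrite (le_trans (rnorm_cut_le _ _))// (le_trans (abe _))//.
by rewrite rnorm_delta rnorm1 mulr1.
Qed.

Lemma near_diagonalD a b (e e' r : R) : near_diagonal a e r -> near_diagonal b e' r ->
  near_diagonal (a \+ b) (e + e') r.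
Proof.
move=> aer be'r y; have [k kE] := cut_linE (R := R) (far r y).
rewrite /= kE linearD -kE (le_trans (rnormD _ _))//.
by apply: lerD; [exact: aer|exact: be'r].
Qed.

Context {Phi : (l2 X -> l2 X) -> (l2 Y -> l2 Y)}
  {Psi : (l2 Y -> l2 Y) -> (l2 X -> l2 X)}
  (PhiP : star_iso_inverse Phi Psi).
Context {w : Y -> l2 X}
  (wE : forall a, uniform_roe_algebra X a -> forall y z,
    Phi a (delta y (1 : C)) z = inner (a (w y)) (w z)).

(** For self-adjoint [a], the squared norm of the column is the diagonal entry at [y] of the image
    of [a \o a], which [wE] evaluates as the squared norm of [a (w y)]. *)
Lemma star_iso_column a y : uniform_roe_algebra X a -> is_adjoint a a ->
  rnorm (Phi a (delta y (1 : C))) = rnorm (a (w y)).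
Proof.
move=> Sa aa; apply/eqP; rewrite -(@eqrXn2 _ 2)// ?rnorm_ge0//; apply/eqP.
rewrite -!rnorm_inner_self; congr rnorm.
have PP : is_adjoint (Phi a) (Phi a) := star_iso_adj PhiP Sa Sa aa.
have Saa := uniform_roe_comp Sa Sa.
transitivity (Phi (a \o a) (delta y (1 : C)) y).
  by rewrite (star_isoM PhiP Sa Sa) -PP inner_basis.
rewrite (wE Saa); exact: aa.
Qed.

Lemma star_iso_cutU (A B : set X) : A `&` B = set0 ->
  Phi (cut (A `|` B)) = Phi (cut A) \+ Phi (cut B).
Proof.
move=> AB; rewrite -(star_isoD PhiP); [|exact: uniform_roe_cut..].
by congr Phi; apply/funext => f; exact: cut_setU.
Qed.

Lemma star_iso_cutB_column (A B : set X) y :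
  rnorm (Phi (cut A) (delta y (1 : C)) - Phi (cut B) (delta y (1 : C))) =
  rnorm (cut A (w y) - cut B (w y)).
Proof.
have SA := uniform_roe_cut A; have SB := uniform_roe_cut B.
have SB' := uniform_roeZ (-1) SB.
have SD := uniform_roeD SA SB'.
have := @star_iso_column _ y SD.
rewrite (star_isoD PhiP SA SB') (star_isoZ PhiP (-1) SB).
rewrite -[X in rnorm X = _]/(_ + -1 *: _) -[X in _ = rnorm X]/(_ + -1 *: _).
rewrite !scaleN1r; apply => f g.
rewrite -[X in inner X _]/(_ + -1 *: _) -[X in _ = inner _ X]/(_ + -1 *: _).
by rewrite !scaleN1r linearBl linearBr/= !inner_cut.
Qed.

(** With [A] and [F] fixed, the sets [B] form a basic open neighbourhood of [A] in the Cantor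
    topology on subsets. *)
Definition agree (F : {fset X}) (A B : set X) : Prop :=
  forall x, x \in F -> (A x <-> B x).

(** Some column [y] exceeds [e] by a positive margin. If [F] carries [w y] up to less than this
    margin, changing [A] off [F] moves the column by less than the margin. *)
Lemma near_diagonal_open (A : set X) (e r : R) : ~ near_diagonal (Phi (cut A)) e r ->
  exists F, forall B, agree F A B -> ~ near_diagonal (Phi (cut B)) e r.
Proof.
move=> /existsNP[y /negP]; rewrite -ltNge -subr_gt0.
set n := rnorm _ => ne.
have [F Ft] := small_tail (w y) ne; exists F => B AB /(_ y).
set m := rnorm _; have : n <= m + rnorm (cut (~` [set` F]) (w y)).
  have [k kE] := cut_linE (R := R) (far r y).
  rewrite /n /m kE -[Phi (cut A) _](subrK (Phi (cut B) (delta y (1 : C)))).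
  rewrite linearD addrC (le_trans (rnormD _ _))// lerD2l -kE.
  rewrite (le_trans (rnorm_cut_le _ _))// star_iso_cutB_column.
  apply: rnorm_le_coord => x; rewrite ell2BE !cutE.
  have [xF|xF] := boolP (x \in F).
    rewrite (_ : (x \in A) = (x \in B)) ?subrr ?rnorm0 ?rnorm_ge0//.
    by apply/idP/idP => /set_mem xA; apply/mem_set/(AB x xF).
  rewrite (_ : (x \in ~` [set` F]) = true); last first.
    by apply/mem_set => /=; exact/negP.
  case: ifP => _; case: ifP => _;
    by rewrite ?subrr ?subr0 ?sub0r ?rnormN ?rnorm0 ?rnorm_ge0.
move: Ft; set t := rnorm _; rewrite -/n; lra.
Qed.

(** One radius serves all subsets of [F]: by induction, splitting off a single point at the cost of
    half the tolerance. *)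
Lemma near_diagonal_finite (F : seq X) (e : R) : 0 < e -> exists2 r : R, 0 <= r &
  forall A, A `<=` [set` F] -> near_diagonal (Phi (cut A)) e r.
Proof.
have nd A e' : 0 < e' -> exists2 r : R, 0 <= r & near_diagonal (Phi (cut A)) e' r.
  by apply/near_diagonal_uniform_roe/(star_iso_mem PhiP)/uniform_roe_cut.
elim: F e => [|x F IH] e e0.
  have [r r0 rP] := nd set0 _ e0; exists r => // A.
  by move=> sA; rewrite (_ : A = set0)// -subset0 => y /sA.
have e20 : 0 < e / 2 by rewrite divr_gt0.
have [r r0 rP] := IH _ e20; have [s s0 sP] := nd [set x] _ e20.
exists (Num.max r s); first by rewrite le_max r0.
move=> A AxF.
have AF : A `\ x `<=` [set` F].
  by move=> y [/AxF /=]; rewrite in_cons => /orP[/eqP|].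
have [xA|xA] := pselect (A x).
  rewrite -(setD1K xA) setUC star_iso_cutU; last first.
    by rewrite -subset0 => y [[_ ?] ?].
  rewrite [e]splitr; apply: near_diagonalD.
    by apply: near_diagonalW (rP _ AF) => //; rewrite le_max lexx.
  by apply: near_diagonalW sP => //; rewrite le_max lexx orbT.
apply: near_diagonalW (rP A _); rewrite ?le_max ?lexx//.
  by rewrite ler_pdivrMr// ler_pMr ?ler1n.
by move=> y Ay; apply: AF; split=> // yx; apply: xA; rewrite -yx.
Qed.

(* Baire category in the Cantor set of subsets of X: each A satisfies
   [near_diagonal (Phi (cut A)) (e / 3) n] for some n, and for fixed n these
   sets are closed; so one of them contains all A agreeing with some A0 on
   some finite F, and changing A on F costs only the bound of
   [near_diagonal_finite]. *)
Lemma near_diagonal_uniform (e : R) : 0 < e -> exists2 r : R, 0 <= r &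
  forall A, near_diagonal (Phi (cut A)) e r.
Proof.
move=> e0; apply: contrapT => nex.
have e30 : 0 < e / 3 by rewrite divr_gt0.
have step (q : nat * (set X * {fset X})) : exists q' : set X * {fset X},
    [/\ {subset q.2.2 <= q'.2}, agree q.2.2 q.2.1 q'.1 &
      forall B, agree q'.2 q'.1 B -> ~ near_diagonal (Phi (cut B)) (e / 3) q.1%:R].
  case: q => n [A F] /=; apply: contrapT => /forallNP stuck.
  (* If the condition cannot be refined so as to defeat the radius [n], then every set in the
     neighbourhood is near-diagonal at [n]. *)
  have {}stuck B : agree F A B -> near_diagonal (Phi (cut B)) (e / 3) n%:R.
    move=> AB; apply: contrapT => /near_diagonal_open[G GP].
    apply: (stuck (B, (F `|` G)%fset)); split=> [x xF|//|D DP]; rewrite ?in_fsetU ?xF//.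
    by apply: GP => x xG; apply: DP; rewrite in_fsetU xG orbT.
  have [r r0 rP] := near_diagonal_finite (F : seq X) e30.
  apply: nex; exists (Num.max n%:R r); first by rewrite le_max ler0n.
  move=> B y; set F' := [set` (F : seq X)] in rP.
  have dj (D : set X) : (B `\` F') `&` (D `&` F') = set0.
    by rewrite -subset0 => x [[_ nx] [_]].
  (* Replacing [B] on [F'] by [A] gives a set in that neighbourhood. Exchanging the two finite parts
     costs another [e / 3] each, hence [e] in total. *)
  have h1 : near_diagonal (Phi (cut ((B `\` F') `|` (A `&` F')))) (e / 3)
      (Num.max n%:R r).
    apply: (near_diagonalW (lexx _) _ (stuck _ _)); first by rewrite le_max lexx.
    by move=> x xF; split=> [Ax|[[_ /(_ xF)]//|[]//]]; right.
  have h2 D : near_diagonal (Phi (cut (D `&` F'))) (e / 3) (Num.max n%:R r).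
    apply: (near_diagonalW (lexx _) _ (rP _ _)); last by move=> x [].
    by rewrite le_max lexx orbT.
  have -> : B = (B `\` F') `|` (B `&` F') by rewrite setUC setUIDK.
  move: (h1 y) (h2 A y) (h2 B y); rewrite !star_iso_cutU// /=.
  set P := Phi _ _; set Q0 := Phi _ _; set Q := Phi _ _.
  have [k kE] := cut_linE (R := R) (far (Num.max n%:R r) y).
  rewrite kE !linearD => PQ0 lQ0 lQ.
  rewrite -[k P](addrK (k Q0)) (le_trans (rnormD _ _))//.
  have := rnormD (k P + k Q0) (- k Q0); rewrite rnormN.
  move: PQ0 lQ0 lQ; set n1 := rnorm _; set n2 := rnorm _; set n3 := rnorm _.
  set n4 := rnorm _; lra.
have [next nextP] := choice step.
(* Stage [n + 1] defeats the radius [n], starting from the empty condition. *)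
pose s n := iteri n (fun k q => next (k, q)) (set0, fset0).
have sP n : [/\ {subset (s n).2 <= (s n.+1).2}, agree (s n).2 (s n).1 (s n.+1).1 &
    forall B, agree (s n.+1).2 (s n.+1).1 B ->
      ~ near_diagonal (Phi (cut B)) (e / 3) n%:R].
  exact: nextP (n, s n).
have mono m n : (m <= n)%N ->
    {subset (s m).2 <= (s n).2} /\ agree (s m).2 (s m).1 (s n).1.
  move=> /subnK <-; elim: (n - m)%N => [|k [sub ag]]; first by split.
  rewrite addSn; have [sub' ag' _] := sP (k + m)%N; split=> x xm.
    exact/sub'/sub.
  by rewrite ag// ag'//; exact: sub.
pose A := [set x | exists2 n, x \in (s n).2 & (s n).1 x].
have agA n : agree (s n).2 (s n).1 A.
  move=> x xn; split=> [snx|[m xm smx]]; first by exists n.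
  have [mn|/ltnW nm] := leqP m n; first by apply/(mono _ _ mn).2.
  by apply/(mono _ _ nm).2.
(* The limit set [A] agrees with every stage, yet its own image is near-diagonal at some radius,
   which a later stage excludes. *)
have [r r0 rA] := near_diagonal_uniform_roe
  (star_iso_mem PhiP (uniform_roe_cut A)) e30.
have [_ _ /(_ A (agA _))] := sP (Num.bound r); apply.
by apply: near_diagonalW rA => //; rewrite ltW// archi_boundP.
Qed.

End equi_approximation.

(** * Large coefficients and localization *)

Section finite_balls.
Context {R : realType}.

Lemma finite_balls (X : metricType R) (r : R) : uniformly_locally_finite X ->
  exists (N : nat) (B : X -> {fset X}), forall x,
    (#|` B x| <= N)%N /\ forall y, (y \in B x) = (mdist x y <= r).
Proof.
(* Uniform local finiteness concerns positive radii only, so the points are counted in a possibly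
   larger ball. *)
move=> ulf; have r1 : 0 < Num.max r 1 by rewrite lt_max ltr01 orbT.
have [N NP] := ulf _ r1; exists N.
suff /choice[B BP] : forall x : X, exists B : {fset X},
    (#|` B| <= N)%N /\ forall y, (y \in B) = (mdist x y <= r) by exists B.
move=> x; have fin : finite_set [set y | mdist x y <= Num.max r 1].
  exact: card_le_finite (NP x) (finite_II N).
have sub : [set y | mdist x y <= r] `<=` [set y | mdist x y <= Num.max r 1].
  by move=> y /= xy; rewrite le_max xy.
have finr := sub_finite_set sub fin.
exists (fset_set [set y | mdist x y <= r]); split; last first.
  move=> y; rewrite in_fset_set//.
  by apply/idP/idP => [/set_mem//|xy]; exact/mem_set.
by apply: geq_card_fset_set; apply: card_le_trans (NP x); exact: subset_card_le.
Qed.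

End finite_balls.

(** * Choice of signs for an additive set function *)

Section signs.
Context {R : realType} {X : choiceType} {V : preHilbertType R}.

(* By the parallelogram identity, one of the two signs of each new term does
   not increase the squared norm by more than the square of that term. *)
Lemma exists_signs (t : set X -> V) (s : seq X) :
  (forall A B, A `&` B = set0 -> t (A `|` B) = t A + t B) -> uniq s ->
  exists2 A, A `<=` [set` s] &
    rnorm (t A - t ([set` s] `\` A)) ^+ 2 <= \sum_(x <- s) rnorm (t [set x]) ^+ 2.
Proof.
move=> tU; have t0 : t set0 = 0.
  have := tU set0 set0 (set0I _); rewrite setU0 => /eqP.
  by rewrite -subr_eq0 opprD addNKr oppr_eq0 => /eqP.
elim: s => [_|x s IH /= /andP[xs us]].
  by exists set0 => //; rewrite set_nil setD0 subrr rnorm0 expr0n big_nil.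
have [A As At] := IH us.
set T := [set` s] in As At *.
have xT : ~ T x by move=> /= h; rewrite h in xs.
have xA : ~ A x by move/As.
have -> : [set` x :: s] = [set x] `|` T.
  by apply/seteqP; split => y; rewrite /T/= in_cons;
    [move=> /orP[/eqP|]; [left|right]|move=> [->|->]; rewrite ?eqxx ?orbT].
rewrite big_cons.
set v := t A - t (T `\` A) in At.
have [le|le] : rnorm (v + t [set x]) ^+ 2 <= rnorm v ^+ 2 + rnorm (t [set x]) ^+ 2 \/
   rnorm (v - t [set x]) ^+ 2 <= rnorm v ^+ 2 + rnorm (t [set x]) ^+ 2.
  apply/orP; rewrite -[_ || _]negbK negb_or -!ltNge; apply/negP => /andP[].
  have := parallelogram v (t [set x]); rewrite mulr2n.
  set p := rnorm (v + _) ^+ 2; set q := rnorm (v - _) ^+ 2.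
  set a := rnorm v ^+ 2; set b := rnorm (t _) ^+ 2; lra.
- exists (A `|` [set x]).
    by move=> y [/As|]; [right|left].
  rewrite tU; last by rewrite -subset0 => y [Ay yx]; apply: xA; rewrite -yx.
  rewrite (_ : _ `\` _ = T `\` A); last first.
    apply/seteqP; split => y.
      by move=> [[yx|yT] ny]; [case: ny; right|split=> // yA; apply: ny; left].
    by move=> [yT yA]; split; [right|move=> [//|yx]; apply: xT; rewrite -yx].
  by rewrite addrAC (le_trans le)// addrC lerD2l.
- exists A; first by move=> y /As; right.
  rewrite (_ : _ `\` _ = (T `\` A) `|` [set x]); last first.
    apply/seteqP; split => y.
      by move=> [[yx|yT] ny]; [right|left].
    by move=> [[yT yA]|yx]; split=> //; [right|left|move=> yA; apply: xA; rewrite -yx].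
  rewrite tU; last by rewrite -subset0 => y [[yT _] yx]; apply: xT; rewrite -yx.
  by rewrite opprD addrA (le_trans le)// addrC lerD2l.
Qed.

End signs.

(** * Lower bounds on coefficients of the implementing vectors *)

Section large_coefficients.
Context {R : realType} {X Y : metricType R}.
Local Notation C := (R[i]^o).
Local Notation l2 X := (ell2 X C).
Context {Phi : (l2 X -> l2 X) -> (l2 Y -> l2 Y)}
  {Psi : (l2 Y -> l2 Y) -> (l2 X -> l2 X)}
  (PhiP : star_iso_inverse Phi Psi).
Context {u : X -> l2 Y} {w : Y -> l2 X}.
Context (w1 : forall y, rnorm (w y) = 1)
  (uE : forall x eta, Phi (matrix_unit x x) eta = inner eta (u x) *: u x)
  (wE : forall a, uniform_roe_algebra X a -> forall y z,
    Phi a (delta y (1 : C)) z = inner (a (w y)) (w z)).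

(** Both squares equal the diagonal entry at [y] of the image of the rank-one projection at [x]. *)
Lemma rnorm_coefficient_sym x y : rnorm (u x y) = rnorm (w y x).
Proof.
apply/eqP; rewrite -(@eqrXn2 _ 2)// ?rnorm_ge0//; apply/eqP/complexI.
rewrite -!inner_rnorm.
transitivity (Phi (matrix_unit x x) (delta y (1 : C)) y).
  by rewrite uE ell2ZE [inner (delta _ _) _]inner_conj inner_basis [RHS]mulrC.
rewrite (wE (uniform_roe_matrix_unit x x)) /matrix_unit linearZl_LR/=.
by rewrite [inner (delta _ _) _]inner_conj inner_basis.
Qed.

Lemma star_iso_cut1_column x y : Phi (cut [set x]) (delta y (1 : C)) = (u x y)^* *: u x.
Proof. by rewrite -matrix_unit_diag uE inner_conj inner_basis. Qed.

(* For a signed diagonal operator D supported on a finite set F carrying most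
   of w y, the column of Phi D at y has norm at least sqrt (3/4); by uniform
   near-diagonality most of it lies in a ball with at most N points, where a
   suitable choice of signs makes it of size at most sqrt N * sup |w y|. *)
Lemma large_coefficient : uniformly_locally_finite Y ->
  exists2 d : R, 0 < d & forall y, exists x, d <= rnorm (w y x).
Proof.
move=> ulf; have q0 : 0 < 4^-1 :> R by rewrite invr_gt0.
have [r r0 rP] := near_diagonal_uniform PhiP wE q0.
have [N [B BP]] := finite_balls r ulf.
(* Chosen so that [d ^+ 2 * N%:R] is at most 1/8. *)
pose d : R := (8 * N.+1%:R)^-1.
have d0 : 0 < d by rewrite invr_gt0 mulr_gt0.
have dN : d ^+ 2 * N%:R <= 8^-1.
  have dN8 : d * N.+1%:R = 8^-1.
    by rewrite /d invfM -mulrA mulVf ?mulr1// pnatr_eq0.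
  have d1 : d <= 1.
    by rewrite invf_le1 ?mulr_gt0// mulr_ege1// ler1n.
  rewrite -dN8 expr2 -mulrA (le_trans (y := 1 * (d * N%:R)))//.
    by rewrite ler_wpM2r// mulr_ge0 // ltW.
  by rewrite mul1r ler_pM2l// ler_nat.
exists d => // y; apply: contrapT => /forallNP small.
have {}small x : rnorm (w y x) < d by rewrite ltNge; apply/negP/small.
have [F Ftail] := small_tail (w y) (divr_gt0 ltr01 (ltr0n R 2)).
pose K := ~` far r y.
pose t A := cut K (Phi (cut A) (delta y (1 : C))).
have [k kE] := cut_linE (R := R) K.
have tU A D : A `&` D = set0 -> t (A `|` D) = t A + t D.
  by move=> AD; rewrite /t (star_iso_cutU PhiP AD) kE linearD.
have [A AF At] := exists_signs tU (fset_uniq F).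
set D := [set` (F : seq X)] `\` A in At.
pose v := Phi (cut A) (delta y (1 : C)) - Phi (cut D) (delta y (1 : C)).
have v_ge : rnorm (cut [set` F] (w y)) <= rnorm v.
  rewrite (star_iso_cutB_column PhiP wE); apply: rnorm_le_coord => x.
  rewrite ell2BE !cutE; case: ifPn => [/set_mem xF|_]; last first.
    by rewrite rnorm0 rnorm_ge0.
  have [xA|xA] := boolP (x \in A).
    rewrite (_ : (x \in D) = false) ?subr0//.
    by apply/negP => /set_mem[_]; apply; exact: set_mem.
  rewrite (_ : (x \in D) = true) ?sub0r ?rnormN//.
  by apply/mem_set; split=> // xA'; move/negP: xA; apply; exact/mem_set.
have v_far : rnorm (cut (far r y) v) <= 2^-1.
  have [f fE] := cut_linE (R := R) (far r y).
  rewrite /v fE linearB -fE (le_trans (rnormD _ _))// rnormN.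
  by move: (rP A y) (rP D y); set a := rnorm _; set b := rnorm _; lra.
(* The term at [x] has squared norm at most [d ^+ 2] times the sum of [rnorm (w z x) ^+ 2] over [z]
   in the ball. Exchanging the sums, each of the at most [N] unit vectors [w z] contributes at most
   1. *)
have v_near : rnorm (cut K v) ^+ 2 <= 8^-1.
  rewrite /v kE linearB -kE; apply: le_trans At _; apply: le_trans dN.
  apply: (@le_trans _ _ (\sum_(x <- F) d ^+ 2 *
      \sum_(z <- B y) rnorm (w z x) ^+ 2)).
    apply: ler_sum => x _; rewrite /t star_iso_cut1_column kE linearZ -kE.
    rewrite rnormZ exprMn rnorm_conj rnorm_coefficient_sym.
    apply: ler_pM; rewrite ?sqr_ge0//.
      by rewrite lerXn2r ?nnegrE ?rnorm_ge0 ?ltW.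
    have -> : K = [set` B y].
      apply/seteqP; split=> z; rewrite /K /far /=.
        by move=> /negP; rewrite -leNgt (BP y).2.
      by rewrite (BP y).2 => h; apply/negP; rewrite -leNgt.
    rewrite cut_fset rnorm_comb.
    by apply: ler_sum => z _; rewrite rnorm_coefficient_sym.
  rewrite -mulr_sumr ler_wpM2l ?sqr_ge0// exchange_big/=.
  apply: (@le_trans _ _ (\sum_(z <- B y) 1)).
    apply: ler_sum => z _; rewrite (le_trans (ell2_sum_le _ _))//.
    by rewrite w1 expr1n.
  by rewrite big_const_seq count_predT iter_addr_0 ler_nat; case: (BP y).
(* The squared norm of [v] is at least 3/4 since [F] misses less than 1/4 of [w y], but at most 1/4
   + 1/8 by the far and near bounds. *)
have := cut_pythagoras (far r y) v; have := cut_pythagoras [set` F] (w y).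
rewrite w1 expr1n -/K.
have sq (a b : R) : 0 <= a -> a <= b -> a ^+ 2 <= b ^+ 2.
  by move=> a0 ab; rewrite lerXn2r ?nnegrE// (le_trans a0).
move: (sq _ _ (rnorm_ge0 _) v_far) (sq _ _ (rnorm_ge0 _) (ltW Ftail))
  (sq _ _ (rnorm_ge0 _) v_ge) v_near.
rewrite !exprVn !exprMn.
set a1 := rnorm v ^+ 2; set a2 := rnorm (cut K v) ^+ 2.
set a3 := rnorm (cut (far r y) v) ^+ 2.
set b1 := rnorm (cut [set` F] _) ^+ 2; set b2 := rnorm (cut (~` [set` F]) _) ^+ 2.
lra.
Qed.

(** The column at [f x] of the image of the projection at [x] is a multiple of [u x] with factor of
    modulus at least [d]; uniform near-diagonality at tolerance [e * d] is divided by it. *)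
Lemma localized_vectors (f : X -> Y) (d : R) : 0 < d ->
  (forall x, d <= rnorm (u x (f x))) ->
  forall e : R, 0 < e -> exists2 r : R, 0 <= r &
    forall x, rnorm (cut (far r (f x)) (u x)) <= e.
Proof.
move=> d0 df e e0; have [r r0 rP] := near_diagonal_uniform PhiP wE (mulr_gt0 e0 d0).
exists r => // x; have := rP [set x] (f x).
have [k kE] := cut_linE (R := R) (far r (f x)).
rewrite star_iso_cut1_column kE linearZ -kE rnormZ rnorm_conj => h.
rewrite -(ler_pM2r d0); apply: le_trans h; rewrite mulrC.
by rewrite ler_wpM2r ?rnorm_ge0.
Qed.

End large_coefficients.

(** * The induced coarse equivalence *)

Section adjacency.
Context {R : realType} {X : metricType R}.
Local Notation C := (R[i]^o).
Local Notation l2 := (ell2 X C).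

(** Cauchy-Schwarz against the indicator of [A]. *)
Lemma rnorm_sum_le (A : {fset X}) (f : l2) :
  rnorm (\sum_(x <- A) f x : C) ^+ 2 <= #|` A|%:R * \sum_(x <- A) rnorm (f x) ^+ 2.
Proof.
have -> : \sum_(x <- A) f x = inner (comb A f) (comb A (fun=> 1)) :> C.
  rewrite /comb linear_sumr/=; apply: eq_big_seq => x xA.
  by rewrite scale1r inner_basis -/(comb A f) combE xA.
rewrite -rnorm_comb.
have -> : #|` A|%:R = rnorm (comb A (fun=> 1 : C)) ^+ 2 :> R.
  by rewrite rnorm_comb rnorm1 expr1n big_const_seq count_predT iter_addr_0.
rewrite mulrC -exprMn lerXn2r ?nnegrE ?mulr_ge0 ?rnorm_ge0//.
exact: rnorm_inner_le.
Qed.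

(** The 0-1 matrix of the relation has at most [N] ones in each row and column, so its norm is at
    most [N]. *)
Lemma banded_adjacency (s : R) : 0 <= s -> uniformly_locally_finite X ->
  exists2 v : l2 -> l2, banded v &
    forall x y, mdist x y <= s -> v (delta x (1 : C)) y = 1.
Proof.
move=> s0 ulf; have [N [B BP]] := finite_balls s ulf.
have Bsym x y : (x \in B y) = (y \in B x).
  by rewrite (BP x).2 (BP y).2 metric_sym.
have bound (f : l2) (A : {fset X}) :
    \sum_(x <- A) rnorm (\sum_(z <- B x) f z : C) ^+ 2 <= (N%:R * rnorm f) ^+ 2.
  apply: (@le_trans _ _ (\sum_(x <- A) N%:R * \sum_(z <- B x) rnorm (f z) ^+ 2)).
    apply: ler_sum => x _; rewrite (le_trans (rnorm_sum_le _ _))//.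
    rewrite ler_wpM2r ?ler_nat ?(BP x).1// sumr_ge0// => z _.
    by rewrite sqr_ge0.
  rewrite -mulr_sumr exprMn expr2 -mulrA ler_wpM2l//.
  (* All inner sums are extended to the union of the balls so that the summations can be exchanged;
     by symmetry a point [z] lies in at most [N] of these balls. *)
  pose U := (\bigcup_(x <- A) B x)%fset.
  have BU x : x \in A -> {subset B x <= U}.
    by move=> xA z zx; apply/bigfcupP; exists x; rewrite ?xA.
  have -> : \sum_(x <- A) \sum_(z <- B x) rnorm (f z) ^+ 2 =
      \sum_(x <- A) \sum_(z <- U | z \in B x) rnorm (f z) ^+ 2.
    apply: eq_big_seq => x xA; rewrite [RHS]big_fset_condE/=.
    apply: eq_fbigl => z; rewrite !inE/=.
    by apply/idP/andP => [zx|[]//]; split=> //; exact: BU zx.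
  rewrite (exchange_big_dep predT)//=.
  apply: (@le_trans _ _ (\sum_(z <- U) N%:R * rnorm (f z) ^+ 2)).
    apply: ler_sum => z _; rewrite big_fset_condE/= big_const_seq count_predT.
    rewrite iter_addr_0 -[X in X <= _]mulr_natl ler_wpM2r ?sqr_ge0// ler_nat.
    rewrite (leq_trans _ (BP z).1)// fsubset_leq_card//.
    by apply/fsubsetP => x; rewrite !inE/= => /andP[_]; rewrite Bsym.
  by rewrite -mulr_sumr ler_wpM2l// ell2_sum_le.
have ell2v (f : l2) : (fun x => \sum_(z <- B x) f z : C) \in @ell2_pred R X C.
  by apply/asboolP/square_summableP; exists ((N%:R * rnorm f) ^+ 2); exact: bound.
exists (fun f => Ell2 (ell2v f)).
  split.
  - move=> c f g; apply: ell2P => x.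
    rewrite -[LHS]/(\sum_(z <- B x) (c *: f + g) z).
    rewrite -[RHS]/(c *: (\sum_(z <- B x) f z : C) + \sum_(z <- B x) g z).
    by rewrite scaler_sumr -big_split.
  - exists N%:R => // f; apply: ell2_norm_le; last exact: bound.
    by rewrite mulr_ge0 ?rnorm_ge0.
  - exists s => // x y xy; rewrite -[LHS]/(\sum_(z <- B y) delta x (1 : C) z).
    rewrite big_seq big1// => z zy; rewrite basisE; case: eqVneq => // zx.
    by move: zy; rewrite zx (BP y).2 metric_sym leNgt xy.
move=> x y xy; rewrite -[LHS]/(\sum_(z <- B y) delta x (1 : C) z).
have xB : x \in B y by rewrite (BP y).2 metric_sym.
rewrite (big_fsetD1 x xB) basisE eqxx big_seq big1 => [|z].
  by rewrite /= addr0.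
by rewrite !inE basisE => /andP[/negbTE ->].
Qed.

End adjacency.

Section coarse.
Context {R : realType} {X Y : metricType R}.
Local Notation C := (R[i]^o).
Local Notation l2 X := (ell2 X C).
Context {Phi : (l2 X -> l2 X) -> (l2 Y -> l2 Y)}
  {Psi : (l2 Y -> l2 Y) -> (l2 X -> l2 X)}
  (PhiP : star_iso_inverse Phi Psi).
Context {u : X -> l2 Y} (u1 : forall x, rnorm (u x) = 1)
  (uE : forall b, uniform_roe_algebra Y b -> forall x x',
    Psi b (delta x (1 : C)) x' = inner (b (u x)) (u x')).
Context {f : X -> Y} (f_loc : forall e : R, 0 < e -> exists2 r, 0 <= r &
    forall x, rnorm (cut (far r (f x)) (u x)) <= e).

(* With v the adjacency operator of {d <= s}, <Phi v (u x), u x'> = 1 whenever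
   d x x' <= s; but Phi v is nearly banded and u x, u x' are concentrated near
   f x, f x', so these two points cannot be far apart. *)
Lemma coarse_lipschitz : uniformly_locally_finite X ->
  forall s : R, 0 < s -> exists2 r : R, 0 < r &
    forall x x', mdist x x' < s -> mdist (f x) (f x') < r.
Proof.
move=> ulf s s0; have [v vb vE] := banded_adjacency (ltW s0) ulf.
have Sv := uniform_roe_banded vb; have Tv := star_iso_mem PhiP Sv.
have [_ _ approx] := (uniform_roeP _).1 Tv.
have q0 : 0 < 4^-1 :> R by rewrite invr_gt0.
have [b [bl [M M0 bM] [t t0 bt]] vbq] := approx _ q0.
have M1 : 0 < M + 1 by rewrite ltr_wpDl.
have [r r0 rP] := f_loc (divr_gt0 q0 M1).
(* Beyond [r + t + r] the two [r]-balls are more than [t] apart; the 1 ensures positivity. *)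
exists (r + t + r + 1); first by rewrite ltr_wpDl// !addr_ge0.
move=> x x' xx'; rewrite ltNge; apply/negP => ff'.
have : inner (Phi v (u x)) (u x') = 1.
  by rewrite -(uE Tv) (star_isoK PhiP Sv) vE// ltW.
set K := ~` far r (f x); set K' := ~` far r (f x').
have [B BE] := linear_opP bl; rewrite BE in vbq bM bt.
have Kfar : cut K' (B (cut K (u x))) = 0.
  apply: ell2P => z; rewrite cutE ell20E; case: ifPn => // /set_mem.
  rewrite /K' /far /= => /negP; rewrite -leNgt => z'.
  apply: (coord_eq0 (M := M)) => //; first by rewrite -BE.
  move=> y; rewrite cutE; case: ifPn => [/set_mem|]; last by rewrite eqxx.
  rewrite /K /far /= => /negP; rewrite -leNgt => y' _; apply: bt.
  have := metric_triangle (f x) y (f x').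
  have := metric_triangle y z (f x'); rewrite [mdist z _]metric_sym.
  move: ff' y' z'; lra.
(* [B] sends the near part of [u x] to a vector vanishing near [f x'], so only the far part of
   [u x'] meets it. Each of the three terms is at most 1/4, while their sum should be 1. *)
have -> : inner (Phi v (u x)) (u x') = inner ((Phi v \- B) (u x)) (u x') +
    inner (B (cut (far r (f x)) (u x))) (u x') +
    inner (B (cut K (u x))) (cut (far r (f x')) (u x')).
  rewrite -[RHS]addrA.
  have -> : inner (B (cut K (u x))) (cut (far r (f x')) (u x')) =
      inner (B (cut K (u x))) (u x').
    rewrite [in RHS](cutD (far r (f x')) (u x')) linearDr/= -/K'.
    by rewrite -[inner _ (cut K' _)]inner_cut Kfar linear0l addr0.
  rewrite -linearDl/= -linearD -cutD -linearDl/=.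
  by rewrite subrK.
move=> /(congr1 (fun c : C => rnorm c)); rewrite rnorm1.
set i1 := inner _ _; set i2 := inner _ _; set i3 := inner _ _.
have h1 : rnorm (i1 : C) <= 4^-1.
  rewrite (le_trans (rnorm_inner_le _ _))// u1 mulr1 (le_trans (vbq _))//.
  by rewrite u1 mulr1.
have Mq : M * (4^-1 / (M + 1)) <= 4^-1.
  by rewrite mulrCA ler_piMr ?(ltW q0)// ler_pdivrMr// mul1r lerDl.
have h2 : rnorm (i2 : C) <= 4^-1.
  rewrite (le_trans (rnorm_inner_le _ _))// u1 mulr1 (le_trans (bM _))//.
  by rewrite (le_trans _ Mq)// ler_wpM2l.
have h3 : rnorm (i3 : C) <= 4^-1.
  rewrite (le_trans (rnorm_inner_le _ _))// (le_trans _ Mq)//.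
  apply: ler_pM; rewrite ?rnorm_ge0//; last exact: rP.
  by rewrite (le_trans (bM _))// -[leRHS]mulr1 ler_wpM2l// -(u1 x) rnorm_cut_le.
have := rnormD (i1 + i2 : C) (i3 : C); have := rnormD (i1 : C) (i2 : C).
move: h1 h2 h3; set n1 := rnorm _; set n2 := rnorm _; set n3 := rnorm _.
set n4 := rnorm _; move=> h1 h2 h3 h4 h5 h6; move: h5; rewrite h6; lra.
Qed.

End coarse.

(** * Assembling two mutually inverse controlled maps *)

Lemma coarse_inverse_close {R : realType} {X Y : metricType R}
    {w : Y -> ell2 X R[i]^o} {f : X -> Y} {g : Y -> X} (d : R) : 0 < d ->
  (forall x, d <= rnorm (w (f x) x)) ->
  (forall e : R, 0 < e -> exists2 r : R, 0 <= r &
    forall y, rnorm (cut (far r (g y)) (w y)) <= e) ->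
  exists2 r : R, 0 <= r & forall x, mdist (g (f x)) x <= r.
Proof.
move=> d0 df /(_ (d / 2))[|r r0 rP]; first by rewrite divr_gt0.
(* Otherwise the coefficient of [w (f x)] at [x], at least [d], would belong to a tail of norm at
   most [d / 2]. *)
exists r => // x; rewrite leNgt; apply/negP => far_x.
have := le_trans (rnorm_coord_le _ x) (rP (f x)).
rewrite cutE (_ : (x \in _) = true); last exact/mem_set.
by move: (df x); set n := rnorm _; lra.
Qed.

Theorem proposition5p4 (R : realType) (H : hilbertType R) (X : metricType R) :
  infinite_dimensional H -> separable H ->
  uniformly_locally_finite X ->
  sparse_subspaces_only_compact_ghost_projections H X ->
  uniform_roe_rigid X.
Proof.
move=> _ _ ulfX _ Y ulfY /star_isomorphic_inverse[Phi [Psi [PhiP PsiP]]].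
have [u [u1 uE uT]] := implementing_vectors PhiP PsiP.
have [w [w1 wE wS]] := implementing_vectors PsiP PhiP.
have [d d0 /choice[g gP]] := large_coefficient PhiP w1 uE wS ulfY.
have [c c0 /choice[f fP]] := large_coefficient PsiP u1 wE uT ulfX.
have f_loc := localized_vectors PhiP uE wS c0 fP.
have g_loc := localized_vectors PsiP wE uT d0 gP.
have f_lip := coarse_lipschitz PhiP u1 uT f_loc ulfX.
have g_lip := coarse_lipschitz PsiP w1 wS g_loc ulfY.
have sym := rnorm_coefficient_sym uE wS.
have [r r0 gf] : exists2 r : R, 0 <= r & forall x, mdist (g (f x)) x <= r.
  by apply: (coarse_inverse_close c0 _ g_loc) => x; rewrite -sym.
have [s s0 fg] : exists2 s, 0 <= s & forall y, mdist (f (g y)) y <= s.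
  by apply: (coarse_inverse_close d0 _ f_loc) => y; rewrite sym.
exists f; split => //.
(* Expansion of [f] comes from control of [g]: if the images are within [t], then [x] and [x'] are
   within [r + q + r]. The bound [t + 1] turns the weak inequality into the strict one that [g_lip]
   takes. *)
- move=> t t0; have t1 : 0 < t + 1 by rewrite addr_gt0.
  have [q q0 qP] := g_lip _ t1; exists (r + q + r).
    by rewrite ltr_wpDr// ltr_wpDl.
  move=> x x' far_xx'; rewrite ltNge; apply/negP => ff'.
  have /qP gg' : mdist (f x) (f x') < t + 1 by rewrite (le_lt_trans ff')// ltrDl.
  have := metric_triangle x (g (f x)) x'.
  have := metric_triangle (g (f x)) (g (f x')) x'.
  have := gf x; have := gf x'; rewrite [mdist _ x]metric_sym.
  move: far_xx' gg'; lra.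
(* The point [g y] witnesses that [y] is within [s] of the image of [f]. *)
- apply: (@le_lt_trans _ _ s%:E); last by rewrite ltry.
  apply: ge_ereal_sup => _ [y _ <-].
  apply: (@le_trans _ _ (mdist y (f (g y)))%:E).
    by apply: ereal_inf_lbound; exists (g y).
  by rewrite lee_fin metric_sym.
Qed.
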